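(* Let $\Delta$ be a finite simplicial complex whose $h$-vector is nonnegative and symmetric. Then the $\gamma$-vector of the interval subdivision $\mathrm{Int}(\Delta)$ is the $f$-vector of some balanced simplicial complex.
   Context: For a $(d-1)$-dimensional simplicial complex $\Delta$ let $f_i$ be the number of faces with $i$ elements ($f_0=1$ for the empty face), $f_\Delta(t)=\sum_{i=0}^d f_i t^i$, and define the $h$-polynomial $h_\Delta(t)=(1-t)^d f_\Delta(t/(1-t))=\sum_{i=0}^d h_i t^i$; $h(\Delta)=(h_0,\dots,h_d)$ is the $h$-vector. It is symmetric if $h_i=h_{d-i}$ for all $i$; in that case there are unique integers $\gamma_i$ with $h_\Delta(t)=\sum_{i=0}^{\lfloor d/2\rfloor}\gamma_i t^i(1+t)^{d-2i}$, and $\gamma(\Delta)=(\gamma_0,\dots,\gamma_{\lfloor d/2\rfloor})$ is the $\gamma$-vector. The interval subdivision $\mathrm{Int}(\Delta)$ is the order complex (simplicial complex of all chains) of the poset $\{[A,B]:\emptyset\neq A\subseteq B\in\Delta\}$ ordered by $[A,B]\le[A',B']$ iff $A'\subseteq A\subseteq B\subseteq B'$; it is a subdivision of $\Delta$ of the same dimension. A $(k-1)$-dimensional simplicial complex is balanced if its vertices can be colored with $k$ colors so that the vertices of every face receive distinct colors. *)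

(* Defs.v *)
From HB Require Import structures.
From mathcomp Require Import all_boot all_order all_algebra.
Set Implicit Arguments. Unset Strict Implicit. Unset Printing Implicit Defensive.
Import Order.TTheory GRing.Theory Num.Theory.

Definition simplicial_complex (T : finType) (D : {set {set T}}) : Prop :=
  set0 \in D /\ forall F G : {set T}, F \in D -> G \subset F -> G \in D.

(* d = max face size, so that D has dimension d - 1 *)
Definition cdim (T : finType) (D : {set {set T}}) : nat := \max_(F in D) #|F|.

Definition fnum (T : finType) (D : {set {set T}}) (i : nat) : nat :=
  #|[set F in D | #|F| == i]|.

Local Open Scope ring_scope.

(* h_D(t) = (1-t)^d f_D(t/(1-t)) = sum_i f_i t^i (1-t)^(d-i) *)
Definition hpoly (T : finType) (D : {set {set T}}) : {poly int} :=
  \sum_(i < (cdim D).+1)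
     ((fnum D i)%:R : int) *: ('X^i * (1 - 'X) ^+ (cdim D - i)%N).

Definition gamma_vector (T : finType) (D : {set {set T}}) (g : seq int) : Prop :=
  size g = (cdim D)./2.+1 /\
  hpoly D = \sum_(i < size g) g`_i *: ('X^i * (1 + 'X) ^+ (cdim D - i.*2)%N).

Definition balanced (U : finType) (G : {set {set U}}) : Prop :=
  exists kappa : U -> 'I_(cdim G), forall F, F \in G -> {in F &, injective kappa}.

(* Interval subdivision: the order complex of the poset of intervals [A,B]
   with emptyset <> A ⊆ B ∈ D, ordered by [A,B] <= [A',B'] iff
   A' ⊆ A ⊆ B ⊆ B'.  An interval is encoded as the pair (A, B). *)
Definition is_interval (T : finType) (D : {set {set T}}) (p : {set T} * {set T}) : bool :=
  [&& p.1 != set0, p.1 \subset p.2 & p.2 \in D].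

Definition interval_le (T : finType) (p q : {set T} * {set T}) : bool :=
  (q.1 \subset p.1) && (p.2 \subset q.2).

Definition Int (T : finType) (D : {set {set T}}) : {set {set ({set T} * {set T})}} :=
  [set C : {set ({set T} * {set T})} |
     [forall p in C, is_interval D p] &&
     [forall p in C, forall q in C, interval_le p q || interval_le q p]].

(* Main.v *)
Require Import Defs.
From HB Require Import structures.
From mathcomp Require Import all_boot all_order all_algebra.
From mathcomp Require Import zify ring.
Set Implicit Arguments. Unset Strict Implicit. Unset Printing Implicit Defensive.
Import Order.TTheory GRing.Theory Num.Theory.
Local Open Scope ring_scope.

(** Let [d = cdim D].  The number of multichains of length [m] in the interval poset
is [f(2m) - f(2m-1)], with [f] the f-polynomial of [D].  Writing [f] through [h] and comparing with the series
[sum_m m^i (m+1)^(d-i) t^m = A_(d,i)(t) / (1-t)^(d+1)] shows that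
[h_Int(t^2)] is the even part of [(1+t)^d sum_i h_i A_(d,i)(t)], where [A_(d,i)]
is the Eulerian polynomial of the permutations of [d+1] letters starting with
[i+1].

As [h] is symmetric, only the sums [A_i + A_(d-i)] matter.  Removing the first
letter gives a recursion between these and the polynomials [t A_j + A_(n-j)],
with nonnegative coefficients on the level of gamma-polynomials.  Grouping
the terms of this recursion shows that the gamma-polynomial [g] of
[sum_i h_i A_(d,i)] arises from [1] by steps [p -> p + x q], where [q] occurs
earlier in the same sequence; such a step attaches a cone with a new apex over an
earlier complex, so [g] is the f-polynomial of a complex coloured with [d] colours.

Finally [gamma_r(Int D)] is the coefficient of [y^(2r)] in
[sum_i g_i y^i (1+2y)^(d-i)], which is the f-polynomial of the complex obtained by
adding two vertices of each colour.  The faces with [2r] vertices of a coloured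
complex, cut into consecutive pairs in the order of the colours, are the faces with
[r] vertices of a complex with [d/2] colours. *)

(** * Gamma-polynomials of the symmetrized restricted Eulerian polynomials *)

Lemma sum_nat_flip (V : nmodType) (a : nat -> V) (n m k : nat) : (k <= n.+1)%N ->
  \sum_(m <= j < k) a (n - j)%N = \sum_(n.+1 - k <= j < n.+1 - m) a j.
Proof.
move=> le_kn; case: (leqP m k) => [le_mk|lt_km]; last first.
  by rewrite !big_geq //; lia.
rewrite [RHS]big_nat_rev /= -{1}[m]add0n big_addn -[(n.+1 - k)%N]add0n [RHS]big_addn.
have -> : (n.+1 - m - (0 + (n.+1 - k)) = k - m)%N by lia.
by apply: eq_big_nat => i Hi; congr a; lia.
Qed.

(** The range is stable under [j -> n - j]; each orbit is listed at its smaller element, and the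
    fixed point present for even [n] counts once. *)
Lemma sum_nat_fold (V : nmodType) (a : nat -> V) (n i : nat) : (i.*2 <= n.+1)%N ->
  \sum_(i <= j < n.+1 - i) a j =
  \sum_(i <= j < n./2.+1) (if j.*2 == n then a j else a j + a (n - j)%N).
Proof.
move=> le_in; have [odd_n|ev_n] := boolP (odd n).
  rewrite (big_cat_nat (n := n./2.+1)) /=; try lia.
  have -> : \sum_(n./2.+1 <= j < n.+1 - i) a j = \sum_(i <= j < n./2.+1) a (n - j)%N.
    by rewrite sum_nat_flip; [congr bigop; rewrite /index_iota; congr iota; lia|lia].
  by rewrite -big_split; apply: eq_big_nat => j Hj; case: eqP => //; lia.
case: (ltnP n./2 i) => [lt|le_i]; first by rewrite !big_geq //; lia.
rewrite (big_cat_nat (n := n./2.+1)) /=; try lia.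
have -> : \sum_(n./2.+1 <= j < n.+1 - i) a j = \sum_(i <= j < n./2) a (n - j)%N.
  by rewrite sum_nat_flip; [congr bigop; rewrite /index_iota; congr iota; lia|lia].
rewrite !big_nat_recr //= ifT; last by apply/eqP; lia.
rewrite addrAC -big_split; congr (_ + _).
by apply: eq_big_nat => j Hj; case: eqP => //; lia.
Qed.

(* Descent polynomial of the permutations of n+1 letters with first letter i+1
   (for i <= n), by removal of the first letter. *)
Fixpoint eulerian (n i : nat) : {poly int} :=
  if n is m.+1 then \sum_(0 <= j < n) (if (j < i)%N then 'X else 1) * eulerian m j
  else 1.

(* Gamma-polynomials of [eulS n i] and [eulT n i] below, of degrees n and n+1. The
   values for i outside the ranges in [eulS_expand] carry no meaning. *)
Fixpoint gam (n : nat) : (nat -> {poly int}) * (nat -> {poly int}) :=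
  if n is m.+1 then
    (fun i => (if i.*2 == n then 1 else 2) *: (\sum_(0 <= j < i) (gam m).2 j)
               + \sum_(i <= j < m./2.+1) (gam m).1 j,
     fun i => \sum_(0 <= j < i) (gam m).2 j
               + 2 *: ('X * \sum_(i <= j < m./2.+1) (gam m).1 j))
  else (fun _ => 1, fun _ => 0).

Definition gamA n := (gam n).1.
Definition gamT n := (gam n).2.

Lemma gamAS n i : gamA n.+1 i = (if i.*2 == n.+1 then 1 else 2) *: (\sum_(0 <= j < i) gamT n j)
               + \sum_(i <= j < n./2.+1) gamA n j.
Proof. by []. Qed.

Lemma gamTS n i : gamT n.+1 i = \sum_(0 <= j < i) gamT n j
               + 2 *: ('X * \sum_(i <= j < n./2.+1) gamA n j).
Proof. by []. Qed.

(** The palindromic polynomial with centre [n / 2] and gamma-polynomial [p]. Coefficients of [p]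
    beyond [n./2] are dropped, hence the size bounds below. *)
Definition expand (n : nat) (p : {poly int}) : {poly int} :=
  \sum_(k < n./2.+1) p`_k *: ('X^k * (1 + 'X) ^+ (n - k.*2)).

Lemma expandD n p q : expand n (p + q) = expand n p + expand n q.
Proof. by rewrite -big_split; apply: eq_bigr => k _; rewrite coefD scalerDl. Qed.

Lemma expandZ n c p : expand n (c *: p) = c *: expand n p.
Proof. by rewrite scaler_sumr; apply: eq_bigr => k _; rewrite coefZ scalerA. Qed.

Lemma expand0 n : expand n 0 = 0.
Proof. by apply: big1 => k _; rewrite coef0 scale0r. Qed.

Lemma expand_sum n (I : Type) (r : seq I) (P : pred I) (F : I -> {poly int}) :
  expand n (\sum_(i <- r | P i) F i) = \sum_(i <- r | P i) expand n (F i).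
Proof. exact: (big_morph _ (expandD n) (expand0 n)). Qed.

Lemma expandX n p : expand n.+2 ('X * p) = 'X * expand n p.
Proof.
rewrite /expand /= big_ord_recl /= coefXM eqxx scale0r add0r mulr_sumr.
apply: eq_bigr => k _; rewrite /bump leq0n add1n coefXM /= doubleS !subSS -scalerAr mulrA.
by rewrite -exprS.
Qed.

Lemma expandS n (p : {poly int}) : (size p <= n./2.+1)%N -> expand n.+1 p = (1 + 'X) * expand n p.
Proof.
move=> size_p; pose F k := p`_k *: ('X^k * (1 + 'X) ^+ (n.+1 - k.*2)).
have -> : expand n.+1 p = \sum_(0 <= k < n./2.+1) F k.
  rewrite /expand -(big_mkord xpredT F).
  have : n.+1./2 = n./2 \/ n.+1./2 = n./2.+1 by lia.
  case=> -> //; rewrite big_nat_recr //= {2}/F nth_default ?scale0r ?addr0 //.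
rewrite big_mkord mulr_sumr; apply: eq_bigr => k _; rewrite /F -scalerAr mulrCA -exprS.
by congr (_ *: (_ * _ ^+ _)); have := ltn_ord k; lia.
Qed.

Lemma size_sum_nat (F : nat -> {poly int}) a b s :
  (forall j, size (F j) <= s)%N -> (size (\sum_(a <= j < b) F j)%R <= s)%N.
Proof.
move=> H; apply: (big_ind (fun p : {poly int} => size p <= s)%N) => //.
  by rewrite size_poly0.
by move=> p q Hp Hq; apply: leq_trans (size_polyD _ _) _; rewrite geq_max Hp.
Qed.

Lemma size_gam n i : (size (gamA n i) <= n./2.+1)%N /\ (size (gamT n i) <= n.+1./2.+1)%N.
Proof.
elim: n i => [|n IH] i; first by rewrite /gamA /gamT /= size_poly1 size_poly0.
have HA a b : (size (\sum_(a <= j < b) gamA n j)%R <= n./2.+1)%N.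
  by apply: size_sum_nat => j; case: (IH j).
have HT a b : (size (\sum_(a <= j < b) gamT n j)%R <= n.+1./2.+1)%N.
  by apply: size_sum_nat => j; case: (IH j).
split.
  rewrite gamAS; apply: leq_trans (size_polyD _ _) _; rewrite geq_max.
  rewrite (leq_trans (size_scale_leq _ _)) //=; apply: leq_trans (HA _ _) _; lia.
rewrite gamTS; apply: leq_trans (size_polyD _ _) _; rewrite geq_max.
apply/andP; split; first by apply: leq_trans (HT _ _) _; lia.
apply: leq_trans (size_scale_leq _ _) _; apply: leq_trans (size_polyMleq _ _) _.
by rewrite size_polyX; have := HA i n./2.+1; lia.
Qed.

(** Complementing permutations shows that [eulerian n (n - i)] is the reversal of [eulerian n i] in
    degree [n]; so these sums are palindromic with centres [n / 2] and [(n + 1) / 2]. *)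
Definition eulS n i := if i.*2 == n then eulerian n i else eulerian n i + eulerian n (n - i).
Definition eulT n i := 'X * eulerian n i + eulerian n (n - i).

Lemma eulerianS n i : (i <= n.+1)%N ->
  eulerian n.+1 i = 'X * \sum_(0 <= j < i) eulerian n j + \sum_(i <= j < n.+1) eulerian n j.
Proof.
move=> le_in; rewrite [LHS](big_cat_nat (n := i)) //= mulr_sumr; congr (_ + _).
  by apply: eq_big_nat => j /andP[_ ->].
by apply: eq_big_nat => j /andP[Hj _]; rewrite ltnNge Hj mul1r.
Qed.

(** Let [L], [M], [R] be the sums of [eulerian n j] over [j < i], [i <= j <= n - i] and [j > n - i].
    Then [eulS n.+1 i] is [2 (X L + R) + (1 + X) M], or half of this if [i.*2 = n.+1] (where
    [M = 0]), and [eulT n.+1 i] is [(1 + X) (X L + R) + 2 X M]. Here [X L + R] is a sum of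
    [eulT n j], and [M] folds into a sum of [eulS n j]. *)
Lemma eulS_expand n :
  (forall i, (i <= n./2)%N -> eulS n i = expand n (gamA n i)) /\
  (forall i, (i < n.+1./2)%N -> eulT n i = expand n.+1 (gamT n i)).
Proof.
elim: n => [|n [IHA IHT]].
  split=> // i; rewrite leqn0 => /eqP->; rewrite /eulS /= /expand big_ord1 /gamA /=.
  by rewrite coef1 scale1r expr0 mul1r expr0.
have sumT i : (i <= n.+1./2)%N ->
  \sum_(0 <= j < i) eulT n j = expand n.+1 (\sum_(0 <= j < i) gamT n j).
  by move=> le_i; rewrite expand_sum; apply: eq_big_nat => j Hj; apply: IHT; lia.
have sumA i : (i.*2 <= n.+1)%N ->
   \sum_(i <= j < n.+1 - i) eulerian n j = expand n (\sum_(i <= j < n./2.+1) gamA n j).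
  move=> le_i; rewrite sum_nat_fold // expand_sum; apply: eq_big_nat => j Hj.
  by rewrite -IHA //; lia.
have flipT i : (i <= n.+1)%N ->
   \sum_(0 <= j < i) eulT n j =
   'X * \sum_(0 <= j < i) eulerian n j + \sum_(n.+1 - i <= j < n.+1) eulerian n j.
  move=> le_i; rewrite big_split mulr_sumr /=; congr (_ + _).
  by rewrite sum_nat_flip // subn0.
have sizeT i : (size (\sum_(0 <= j < i) gamT n j)%R <= n.+1./2.+1)%N.
  by apply: size_sum_nat => j; case: (size_gam n j).
have sizeA i : (size (\sum_(i <= j < n./2.+1) gamA n j)%R <= n./2.+1)%N.
  by apply: size_sum_nat => j; case: (size_gam n j).
split=> i le_i.
  rewrite gamAS expandD expandZ -sumT // expandS // -sumA; last by lia.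
  rewrite flipT; last by lia.
  rewrite /eulS; case: eqP => Hi.
    rewrite [X in (1 + _) * X]big_geq; last by lia.
    rewrite mulr0 addr0 scale1r eulerianS; last by lia.
    by congr (_ + bigop _ _ _); rewrite /index_iota; congr iota; lia.
  rewrite !eulerianS; try lia.
  rewrite (big_cat_nat (n := n.+1 - i) (m := i)) /=; try lia.
  rewrite (big_cat_nat (n := i) (m := 0) (p := n.+1 - i)) /=; try lia.
  by rewrite scaler_nat; ring.
rewrite gamTS expandD expandZ expandX -sumA; last by lia.
rewrite expandS // -sumT; last by lia.
rewrite flipT; last by lia.
rewrite /eulT !eulerianS; try lia.
rewrite (big_cat_nat (n := n.+1 - i) (m := i)) /=; try lia.
rewrite (big_cat_nat (n := i) (m := 0) (p := n.+1 - i)) /=; try lia.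
by rewrite scaler_nat; ring.
Qed.

Lemma eulerian_sum_expand n (h : nat -> int) :
  (forall i, (i <= n)%N -> h i = h (n - i)%N) ->
  \sum_(0 <= i < n.+1) h i *: eulerian n i =
  expand n (\sum_(0 <= i < n./2.+1) h i *: gamA n i).
Proof.
move=> symh; have := sum_nat_fold (fun i => h i *: eulerian n i) (i := 0) (n := n) isT.
rewrite subn0 => ->; rewrite expand_sum; apply: eq_big_nat => i Hi.
rewrite expandZ -(proj1 (eulS_expand n)); last by lia.
rewrite /eulS; case: eqP => // _; rewrite scalerDr -symh //; lia.
Qed.

(** * Power series *)

(* Multiplication by 1 - t and by 1 + t on sequences of coefficients. *)
Definition sdiff (phi : nat -> int) (m : nat) : int :=
  phi m - (if m is k.+1 then phi k else 0).
Definition ssum (phi : nat -> int) (m : nat) : int :=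
  phi m + (if m is k.+1 then phi k else 0).

Lemma eq_sdiff n phi psi : phi =1 psi -> iter n sdiff phi =1 iter n sdiff psi.
Proof. by move=> eq_phi; elim: n => // n IH [|m] /=; rewrite /sdiff !IH. Qed.

Lemma eq_ssum n phi psi : phi =1 psi -> iter n ssum phi =1 iter n ssum psi.
Proof. by move=> eq_phi; elim: n => // n IH [|m] /=; rewrite /ssum !IH. Qed.

Lemma iter_sdiff_sum n (I : Type) (r : seq I) (c : I -> int) (F : I -> nat -> int) :
  iter n sdiff (fun m => \sum_(i <- r) c i * F i m) =1
  (fun m => \sum_(i <- r) c i * iter n sdiff (F i) m).
Proof.
elim: n => // n IH m /=; rewrite {1}/sdiff IH; case: m => [|m].
  by rewrite subr0; apply: eq_bigr => i _; rewrite /= /sdiff subr0.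
by rewrite IH -sumrB; apply: eq_bigr => i _; rewrite -mulrBr.
Qed.

Lemma iter_sdiffB n phi psi :
  iter n sdiff (fun m => phi m - psi m) =1
  (fun m => iter n sdiff phi m - iter n sdiff psi m).
Proof.
elim: n => // n IH [|m] /=; rewrite {1}/sdiff !IH /sdiff; ring.
Qed.

Lemma coef_sdiff (p : {poly int}) k : ((1 - 'X) * p)`_k = sdiff (fun i => p`_i) k.
Proof. by rewrite mulrBl mul1r coefB coefXM /sdiff; case: k. Qed.

Lemma coef_ssum (p : {poly int}) k : ((1 + 'X) * p)`_k = ssum (fun i => p`_i) k.
Proof. by rewrite mulrDl mul1r coefD coefXM /ssum; case: k. Qed.

Lemma coef_iter_sdiff n (p : {poly int}) k :
  ((1 - 'X) ^+ n * p)`_k = iter n sdiff (fun i => p`_i) k.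
Proof.
elim: n k => [|n IH] k; first by rewrite mul1r.
rewrite exprS -mulrA coef_sdiff /=; exact: (@eq_sdiff 1).
Qed.

Lemma coef_iter_ssum n (p : {poly int}) k :
  ((1 + 'X) ^+ n * p)`_k = iter n ssum (fun i => p`_i) k.
Proof.
elim: n k => [|n IH] k; first by rewrite mul1r.
rewrite exprS -mulrA coef_ssum /=; exact: (@eq_ssum 1).
Qed.

(** Induction on [n], then on [i]. For [i = 0], factoring [(m+1)^(n+1) - m^(n+1)] yields the series
    of level [n]. The step in [i] writes one factor [m] as [(m + 1) - 1], mirrored by [A_(n+1,i+1) =
    A_(n+1,i) - (1 - t) A_(n,i)]. *)
Lemma eulerian_series n i : (i <= n)%N ->
  iter n.+1 sdiff (fun m => m%:R ^+ i * m.+1%:R ^+ (n - i)) =1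
  (fun k => (eulerian n i)`_k).
Proof.
elim: n i => [|n IHn] i.
  by rewrite leqn0 => /eqP-> [|m] /=; rewrite /sdiff /= !mul1r coef1 // subrr.
elim: i => [_|i IHi lt_in] k.
  rewrite iterSr (eq_sdiff _ (psi := fun m => \sum_(j <- index_iota 0 n.+1)
     1 * (m%:R ^+ j * m.+1%:R ^+ (n - j)))).
    rewrite iter_sdiff_sum eulerianS // [X in _ * X]big_geq // mulr0 add0r coef_sum.
    by apply: eq_big_nat => j Hj; rewrite mul1r IHn.
  case=> [|m].
    rewrite /sdiff mul1r expr1n subr0 big_nat_recl // subn0 expr0 expr1n !mul1r.
    by rewrite big1 ?addr0 // => j _; rewrite expr0n /= mul0r mulr0.
  rewrite /sdiff !mul1r subn0 subrXX -natrB // subSnn mul1r -(big_mkord xpredT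
    (fun i => m.+2%:R ^+ (n.+1.-1 - i) * m.+1%:R ^+ i)).
  by apply: eq_bigr => j _; rewrite mul1r mulrC.
rewrite (eq_sdiff _ (psi := fun m => m%:R ^+ i * m.+1%:R ^+ (n.+1 - i)
           - m%:R ^+ i * m.+1%:R ^+ (n - i))); last first.
  move=> m; rewrite subSS subSn // exprSr exprS.
  by rewrite -[m.+1%:R]natr1; ring.
rewrite iter_sdiffB IHi; last by lia.
have -> : eulerian n.+1 i.+1 = eulerian n.+1 i - (1 - 'X) * eulerian n i.
  rewrite !eulerianS; try lia.
  rewrite big_nat_recr //= [in RHS](big_cat_nat (m := i) (n := i.+1)) //= big_nat1; ring.
by rewrite coefB coef_sdiff; congr (_ - _); apply: (@eq_sdiff 1) => m; apply: IHn.
Qed.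

Lemma ssum_sdiffC n phi : ssum (iter n sdiff phi) =1 iter n sdiff (ssum phi).
Proof.
elim: n => // n IH m; transitivity (sdiff (ssum (iter n sdiff phi)) m); last first.
  exact: (@eq_sdiff 1 _ _ IH).
by rewrite /= /ssum /sdiff; case: m => [|[|m]]; ring.
Qed.

(** Multiplication by [(1 - t)(1 + t) = 1 - t^2] acts on the even coefficients as [1 - t]. *)
Lemma iter_ssum_sdiff_double n phi m :
  iter n ssum (iter n sdiff phi) m.*2 = iter n sdiff (fun k => phi k.*2) m.
Proof.
elim: n phi => // n IH phi; rewrite iterSr (eq_ssum _ (ssum_sdiffC n.+1 phi)) iterSr IH.
rewrite iterSr; apply: eq_sdiff => -[|k]; rewrite /sdiff /ssum ?doubleS /=; ring.
Qed.

(** The Eulerian series has denominator [(1 - t)^(n+1)], one factor more than [(1 + t)^n] can pair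
    with; it remains as the inner [sdiff]. *)
Lemma eulerian_even_series n (h : nat -> int) k :
  ((1 + 'X) ^+ n * \sum_(0 <= i < n.+1) h i *: eulerian n i)`_k.*2 =
  iter n sdiff (fun m =>
     sdiff (fun m => \sum_(0 <= i < n.+1) h i * (m%:R ^+ i * m.+1%:R ^+ (n - i))) m.*2) k.
Proof.
rewrite coef_iter_ssum -(iter_ssum_sdiff_double n) -iterSr.
apply: eq_ssum => m; rewrite iter_sdiff_sum coef_sum; apply: eq_big_nat => i Hi.
by rewrite coefZ eulerian_series.
Qed.

(* Coefficient of t^m in (t / (1 - t))^k. *)
Definition gbin (m k : nat) : nat :=
  match k, m with 0, 0 => 1 | k'.+1, m'.+1 => 'C(m', k') | _, _ => 0 end.

(** [(1 - t)^k (t / (1 - t))^k = t^k]. By Pascal's rule one difference turns [gbin] at [k.+1] into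
    the shift of [gbin] at [k]. *)
Lemma iter_sdiff_gbin k m :
  iter k sdiff (fun m => (gbin m k)%:R) m = (m == k)%:R.
Proof.
elim: k m => [|k IH] m; first by case: m.
rewrite iterSr; case: m => [|m].
  have H n (phi : nat -> int) : phi 0%N = 0 -> iter n sdiff phi 0%N = 0.
    by move=> phi0; elim: n => //= n IHn; rewrite /sdiff IHn subr0.
  by rewrite H // /sdiff /= subr0.
transitivity (iter k sdiff (fun m => (gbin m k)%:R) m : int); last by rewrite IH.
have shift n (phi psi : nat -> int) : phi 0%N = 0 -> (forall m, phi m.+1 = psi m) ->
   forall m, iter n sdiff phi m.+1 = iter n sdiff psi m.
  move=> phi0 phiS; have H0 j : iter j sdiff phi 0%N = 0.
    by elim: j => //= j IHj; rewrite /sdiff IHj subr0.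
  elim: n => // n IHn [|m'] /=; rewrite /sdiff !IHn ?H0 //.
apply: shift => [|j]; rewrite /sdiff /= ?subr0 //.
case: j => [|j] /=; first by case: k {IH} => [|k] //=; rewrite subr0.
by case: k {IH} => [|k]; rewrite ?bin0 ?subrr //= binS natrD addrAC subrr add0r.
Qed.

(** * The f- and h-polynomials as generating functions *)

Lemma coef_hpoly (T : finType) (D : {set {set T}}) k :
  (hpoly D)`_k = iter (cdim D) sdiff
     (fun m => \sum_(0 <= i < (cdim D).+1) (fnum D i)%:R * (gbin m i)%:R) k.
Proof.
rewrite iter_sdiff_sum /hpoly coef_sum big_mkord; apply: eq_bigr => i _.
rewrite coefZ mulrC [in RHS]mulrC; congr (_ * _).
case: i => i /= /[!ltnS] le_i.
rewrite mulrC coef_iter_sdiff -{2}(subnK le_i) iterD; apply: eq_sdiff => m.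
by rewrite iter_sdiff_gbin coefXn.
Qed.

Lemma leq_cdim (T : finType) (D : {set {set T}}) F : F \in D -> (#|F| <= cdim D)%N.
Proof. by move=> FD; exact: (leq_bigmax_cond F). Qed.

Definition fval (T : finType) (D : {set {set T}}) (x : int) : int := \sum_(F in D) x ^+ #|F|.

Lemma sum_by_card (V : nmodType) (T : finType) (D : {set {set T}}) (phi : nat -> V) n :
  (forall F, F \in D -> #|F| < n)%N ->
  \sum_(F in D) phi #|F| = \sum_(0 <= i < n) phi i *+ fnum D i.
Proof.
case: n => [|n] ltD.
  by rewrite big_geq // big1 // => F /ltD.
rewrite (partition_big (fun F : {set T} => inord #|F| : 'I_n.+1) predT) //=.
rewrite big_mkord; apply: eq_bigr => i _; rewrite -sumr_const.
have H F : F \in D -> ((inord #|F| : 'I_n.+1) == i) = (#|F| == i).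
  by move=> FD; rewrite -val_eqE /= inordK // ltD.
apply: eq_big => F; rewrite ?inE; first by case FD : (F \in D); rewrite //= H.
by case/andP => FD; rewrite H // => /eqP->.
Qed.

Lemma fval_fnum (T : finType) (D : {set {set T}}) x :
  fval D x = \sum_(0 <= i < (cdim D).+1) (fnum D i)%:R * x ^+ i.
Proof.
rewrite /fval (sum_by_card (fun i => x ^+ i) (n := (cdim D).+1)); last exact: leq_cdim.
by apply: eq_bigr => i _; rewrite mulr_natl.
Qed.

(** Homogenization in degree [d] is linear, so after binomial expansion monomials suffice. It is
    used with [c = -1] to pass from [h] to [f], with [c = 2] for the even part, and with [c = 1] for
    adding vertices of each colour. *)
Lemma homogenize (R : comNzRingType) (d i : nat) (c : int) (a b : R) : (i <= d)%N ->
  \sum_(0 <= s < d.+1) (('X^i * (1 + c *: 'X) ^+ (d - i))`_s)%:~R * (a ^+ s * b ^+ (d - s))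
  = a ^+ i * (b + c%:~R * a) ^+ (d - i).
Proof.
move=> le_id.
pose E (p : {poly int}) := \sum_(0 <= s < d.+1) (p`_s)%:~R * (a ^+ s * b ^+ (d - s)).
have ED p q : E (p + q) = E p + E q.
  by rewrite -big_split; apply: eq_bigr => j _; rewrite coefD rmorphD mulrDl.
have E0 : E 0 = 0 by apply: big1 => j _; rewrite coef0 mul0r.
have EZ z p : E (z *: p) = z%:~R * E p.
  by rewrite mulr_sumr; apply: eq_bigr => j _; rewrite coefZ rmorphM mulrA.
have EX j : (j <= d)%N -> E 'X^j = a ^+ j * b ^+ (d - j).
  move=> le_jd; rewrite /E big_mkord (bigD1 (Ordinal (le_jd : (j < d.+1)%N))) //=.
  rewrite coefXn eqxx mul1r big1 ?addr0 // => s; rewrite coefXn -val_eqE /= => /negbTE->.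
  by rewrite mul0r.
rewrite -[LHS]/(E _) !exprDn !mulr_sumr (big_morph E ED E0).
apply: eq_bigr => j _; have le_j : (j <= d - i)%N by rewrite -ltnS.
rewrite expr1n mul1r exprZn mulrnAr -scalerAr -exprD -scaler_nat !EZ EX; last by lia.
rewrite exprMn subnDA exprD rmorph_nat rmorphXn /= mulrnAr mulr_natl; congr (_ *+ _).
by move: (a ^+ i) (a ^+ j) (b ^+ _) (_ ^+ j) => w x y z; ring.
Qed.

Lemma fval_hpoly (T : finType) (D : {set {set T}}) (x : int) :
  fval D x = \sum_(0 <= i < (cdim D).+1) (hpoly D)`_i * (x ^+ i * (x + 1) ^+ (cdim D - i)).
Proof.
rewrite fval_fnum; under [RHS]eq_bigr do rewrite /hpoly coef_sum mulr_suml.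
rewrite exchange_big big_mkord; apply: eq_bigr => i _ /=.
under eq_bigr do rewrite coefZ -mulrA; rewrite -mulr_sumr; congr (_ * _).
have le_id : (i <= cdim D)%N by rewrite -ltnS.
(* With [a = x] and [b = x + 1] the base [b - a] is 1, so only [x ^+ i] remains. *)
have := homogenize (-1) x (x + 1) le_id; rewrite mulN1r addrAC subrr add0r expr1n mulr1.
by move=> <-; apply: eq_bigr => s _; rewrite intz scaleN1r.
Qed.

(** * Chains of intervals *)

Section IntervalChains.
Local Open Scope nat_scope.
Variable T : finType.
Implicit Types (A B S : {set T}).

(** Each element of [B :\: A] lies in [C], with weight [y], or outside, with weight [z]. *)
Lemma sum_between A B y z : A \subset B ->
  \sum_(C : {set T} | (A \subset C) && (C \subset B)) y ^ #|C :\: A| * z ^ #|B :\: C|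
  = (y + z) ^ #|B :\: A|.
Proof.
move=> sAB.
(* [f] weighs the elements inside [C] and [g] those outside; a zero weight excludes every [C] not
   between [A] and [B]. *)
pose f i := if i \in A then 1 else if i \in B then y else 0.
pose g i := if i \in A then 0 else if i \in B then z else 1.
transitivity (\prod_i (f i + g i)); last first.
  rewrite (bigID (mem (B :\: A))) /= [X in _ * X]big1 ?muln1; last first.
    by move=> i; rewrite inE /f /g; case: (i \in A); case: (i \in B).
  rewrite -prod_nat_const; apply: eq_bigr => i; rewrite inE /f /g.
  by case/andP => /negbTE-> ->.
rewrite (bigA_distr 1 addn f g) big_mkcond; apply: eq_bigr => C _.
case: ifP => [/andP[sAC sCB]|].
  rewrite (bigID (mem (C :\: A))) /= -prod_nat_const; congr (_ * _).
    apply: eq_bigr => i; rewrite inE /f => /andP[/negbTE-> iC].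
    by rewrite iC (subsetP sCB _ iC).
  rewrite (bigID (mem (B :\: C))) /= [X in _ = _ * X]big1 ?muln1 => [|i]; last first.
    rewrite !inE /f /g; case iC : (i \in C); case iA : (i \in A); case iB : (i \in B) => //=.
    by rewrite (subsetP sAC _ iA) in iC.
  rewrite -prod_nat_const; apply: eq_big => i; rewrite !inE.
    by case iC : (i \in C) => //=; rewrite andbF.
  case/andP => /negbTE iC iB; rewrite iC /g iB.
  by case: ifP => // iA; rewrite (subsetP sAC _ iA) in iC.
move=> nsACB; suff [i Hi] : exists i, (if i \in C then f i else g i) = 0.
  by rewrite (bigD1 i) //= Hi mul0n.
have [sAC|/subsetPn[i iA iC]] := boolP (A \subset C).
  move: nsACB; rewrite sAC /= => /negbT/subsetPn[i iC iB]; exists i.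
  rewrite iC /f (negbTE iB); case: ifP => // iA.
  by rewrite (subsetP sAB _ iA) in iB.
by exists i; rewrite (negbTE iC) /g iA.
Qed.

Variable D : {set {set T}}.
Hypothesis complexD : simplicial_complex D.
Implicit Types (p q : {set T} * {set T}) (C : {set {set T} * {set T}}).
Notation le := (@interval_le T).

Lemma le_int_refl p : le p p. Proof. by rewrite /interval_le !subxx. Qed.

Lemma le_int_trans : transitive le.
Proof.
move=> q p r /andP[H1 H2] /andP[H3 H4].
by rewrite /interval_le (subset_trans H3) ?(subset_trans H2).
Qed.

Lemma le_int_anti p q : le p q -> le q p -> p = q.
Proof.
case: p q => [A B] [A' B'] /andP[/= H1 H2] /andP[/= H3 H4].
by congr (_, _); apply/eqP; rewrite eqEsubset ?H1 ?H2 ?H3 ?H4.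
Qed.

Definition ilen p := #|p.2 :\: p.1|.

Lemma IntP C : reflect
  ((forall p, p \in C -> is_interval D p) /\
   (forall p q, p \in C -> q \in C -> le p q || le q p)) (C \in Int D).
Proof.
rewrite inE; apply: (iffP andP) => -[H1 H2]; split.
- by move=> p pC; apply: (forall_inP H1).
- by move=> p q pC qC; apply: (forall_inP (forall_inP H2 p pC)).
- by apply/forall_inP.
- by apply/forall_inP => p pC; apply/forall_inP => q qC; apply: H2.
Qed.

Lemma Int_sub C C' : C \in Int D -> C' \subset C -> C' \in Int D.
Proof.
move=> /IntP[H1 H2] sC'C; apply/IntP; split=> [p /(subsetP sC'C)/H1 //|p q].
by move=> /(subsetP sC'C) Hp /(subsetP sC'C) Hq; apply: H2.
Qed.

Definition is_max p C := (p \in C) && [forall q in C, le q p].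

Lemma is_max_uniq C p q : is_max p C -> is_max q C -> p = q.
Proof.
move=> /andP[pC /forall_inP maxp] /andP[qC /forall_inP maxq].
by apply: le_int_anti; [apply: maxq|apply: maxp].
Qed.

Lemma is_max_exists C : C \in Int D -> C != set0 -> exists p, is_max p C.
Proof.
move=> /IntP[_ totC] /set0Pn[p0 p0C].
(* This quantity grows strictly with the interval, so a maximizer in a chain is its maximum. *)
case: (@arg_maxnP _ p0 (mem C) (fun p => #|p.2| + #|~: p.1|) p0C) => p pC maxp.
exists p; rewrite /is_max [p \in C]pC; apply/forall_inP => q qC.
case/orP: (totC q p qC pC) => // /andP[H1 H2]; have := maxp q qC.
move: (subset_leq_card H2); have : ~: p.1 \subset ~: q.1 by rewrite setCS.
move=> H3; move: (subset_leq_card H3) => L1 L2 L3.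
have {}L3 : #|q.2| + #|~: q.1| <= #|p.2| + #|~: p.1| := L3.
have E1 : p.2 = q.2.
  apply/eqP; rewrite eqEcard H2 /= -(leq_add2r #|~: p.1|); apply: leq_trans L3.
  by rewrite leq_add2l.
have E2 : ~: p.1 = ~: q.1.
  apply/eqP; rewrite eqEcard H3 /= -(leq_add2l #|p.2|); apply: leq_trans L3.
  by rewrite leq_add2r.
by rewrite /interval_le E1 -(setCK q.1) -E2 setCK !subxx.
Qed.

Definition nchain p k := #|[set C in Int D | is_max p C && (#|C| == k)]|.

(** A nonempty chain has exactly one maximum; as [P] passes to smaller intervals, testing it there
    suffices. *)
Lemma card_chains (P : pred ({set T} * {set T})) k :
  (forall p q, le q p -> P p -> P q) ->
  #|[set C in Int D | [forall p in C, P p] && (#|C| == k.+1)]|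
  = \sum_(p | is_interval D p && P p) nchain p k.+1.
Proof.
move=> downP; rewrite -sum1_card.
transitivity (\sum_(C in [set C in Int D | [forall p in C, P p] && (#|C| == k.+1)])
    \sum_(p | is_interval D p && P p) (is_max p C : nat)).
  apply: eq_bigr => C; rewrite inE => /and3P[IC /forall_inP PC /eqP cC].
  have : C != set0 by rewrite -cards_eq0 cC.
  case/(is_max_exists IC) => p maxp; have pC : p \in C by case/andP: maxp.
  rewrite (bigD1 p) /=; last by rewrite PC // (IntP _ IC).1.
  rewrite maxp big1 // => q /andP[_ neq_qp]; case maxq : (is_max q C) => //.
  by rewrite (is_max_uniq maxq maxp) eqxx in neq_qp.
rewrite exchange_big /=; apply: eq_bigr => p /andP[Ip Pp].
rewrite /nchain -sum1_card big_mkcond [RHS]big_mkcond; apply: eq_bigr => C _.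
rewrite [in LHS]inE [in RHS]inE; case: (C \in Int D) => //=.
case maxp : (is_max p C); last by rewrite /= if_same.
have -> // : [forall p in C, P p].
by apply/forall_inP => q qC; apply: downP Pp; case/andP: maxp => _ /forall_inP; apply.
Qed.

Lemma fnum_Int k : fnum (Int D) k.+1 = \sum_(p | is_interval D p) nchain p k.+1.
Proof.
transitivity (\sum_(p | is_interval D p && xpredT p) nchain p k.+1); last first.
  by apply: eq_bigl => p; rewrite andbT.
rewrite -card_chains //; apply: eq_card => C; rewrite !inE.
by have -> : [forall p in C, xpredT p] by apply/forall_inP.
Qed.

Lemma nchain1 p : is_interval D p -> nchain p 1 = 1.
Proof.
move=> Ip; apply/eqP/cards1P; exists [set p]; apply/setP => C; rewrite in_set1 inE.
apply/idP/eqP => [/and3P[_ /andP[pC _] /cards1P[q defC]]|->].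
  by move: pC; rewrite defC inE => /eqP->.
rewrite cards1 eqxx andbT; apply/andP; split.
  apply/IntP; split=> [q /set1P-> //|q r /set1P-> /set1P->]; first by rewrite le_int_refl.
by rewrite /is_max set11; apply/forall_inP => q /set1P->; rewrite le_int_refl.
Qed.

Definition lt_int q p := le q p && (q != p).

(** Removing the maximum [p] is a bijection onto nonempty chains strictly below [p]. *)
Lemma nchainS p k : is_interval D p ->
  nchain p k.+2 = \sum_(q | is_interval D q && lt_int q p) nchain q k.+1.
Proof.
move=> Ip; rewrite -card_chains; last first.
  move=> q r rq /andP[qp neq_qp]; rewrite /lt_int (le_int_trans rq qp) /=.
  by apply: contraNneq neq_qp => rp; rewrite (le_int_anti qp) // -rp.
rewrite /nchain -(card_in_imset (f := fun C => C :\ p)); last first.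
  move=> C C'; rewrite !inE => /and3P[_ /andP[pC _] _] /and3P[_ /andP[pC' _] _] eqC.
  by rewrite -(setD1K pC) eqC setD1K.
apply: eq_card => C; rewrite inE; apply/imsetP/idP.
  case=> C'; rewrite inE => /and3P[IC' /andP[pC' /forall_inP maxp] /eqP cC'] ->.
  rewrite (Int_sub IC') ?subsetDl //=; apply/andP; split.
    by apply/forall_inP => q; rewrite !inE => /andP[qp qC']; rewrite /lt_int maxp.
  by move: cC'; rewrite (cardsD1 p) pC' add1n => -[->].
case/and3P => IC /forall_inP ltC /eqP cC.
have pC : p \notin C by apply/negP => /ltC; rewrite /lt_int eqxx andbF.
exists (p |: C); last by rewrite setU1K.
rewrite inE cardsU1 pC cC eqxx andbT; apply/andP; split; last first.
  rewrite /is_max setU11; apply/forall_inP => q; rewrite !inE.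
  by case/orP=> [/eqP->|/ltC/andP[]//]; rewrite le_int_refl.
case/IntP: IC => H1 H2; apply/IntP; split=> [q|q r].
  by rewrite !inE => /orP[/eqP->//|]; apply: H1.
rewrite !inE => /orP[/eqP->|qC] /orP[/eqP->|rC].
- by rewrite le_int_refl.
- by case/andP: (ltC _ rC) => ->; rewrite orbT.
- by case/andP: (ltC _ qC) => ->.
- exact: H2.
Qed.

Lemma is_interval_le p q : is_interval D p -> le q p -> q.1 \subset q.2 -> is_interval D q.
Proof.
case/and3P => p0 _ pD /andP[s1 s2] sq; rewrite /is_interval sq (complexD.2 _ _ pD) //= andbT.
by apply: contraNneq p0 => q0; rewrite -subset0 -q0.
Qed.

(** Each element of [p.2 :\: p.1] lies in [q.1], in [q.2 :\: q.1] with weight [x], or outside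
    [q.2]. *)
Lemma sum_below p x : is_interval D p ->
  \sum_(q | is_interval D q && le q p) x ^ ilen q = (x + 2) ^ ilen p.
Proof.
move=> Ip; have sp : p.1 \subset p.2 by case/and3P: Ip.
transitivity (\sum_(A : {set T} | (p.1 \subset A) && (A \subset p.2))
   \sum_(B : {set T} | (A \subset B) && (B \subset p.2)) x ^ #|B :\: A|).
  rewrite pair_big_dep; apply: eq_bigl => -[A B]; rewrite /interval_le /=.
  apply/andP/andP => [[/and3P[/= _ sAB _] /andP[H1 H2]]|[/andP[H1 H2] /andP[H3 H4]]].
    by rewrite H1 H2 sAB (subset_trans sAB).
  by split; [apply: is_interval_le Ip _ _; rewrite /interval_le /= ?H1|rewrite H1].
rewrite (eq_bigr (fun A : {set T} => 1 ^ #|A :\: p.1| * (x + 1) ^ #|p.2 :\: A|)).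
  by rewrite sum_between // addnCA.
move=> A /andP[_ sA]; rewrite exp1n mul1n -(sum_between _ _ sA).
by apply: eq_bigr => B _; rewrite exp1n muln1.
Qed.

(** Both sides count multichains of [m.+1] intervals with top [p]: a chain of [k.+1] intervals can
    be repeated to this length in ['C(m, k)] ways, and by [sum_below] each further interval raises
    the base by 2. *)
Lemma nchain_sum p m : is_interval D p ->
  \sum_(0 <= k < m.+1) nchain p k.+1 * 'C(m, k) = m.*2.+1 ^ ilen p.
Proof.
elim: m p => [|m IH] p Ip; first by rewrite big_nat1 nchain1 // exp1n.
have -> : m.+1.*2.+1 = m.*2.+1 + 2 by lia.
rewrite -sum_below // (bigD1 p) /=; last by rewrite Ip le_int_refl.
rewrite (eq_bigl (fun q => is_interval D q && lt_int q p)); last first.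
  by move=> q; rewrite /lt_int andbA.
rewrite (eq_bigr (fun q => \sum_(0 <= k < m.+1) nchain q k.+1 * 'C(m, k))); last first.
  by move=> q /andP[Iq _]; rewrite IH.
rewrite exchange_big /= -IH // big_nat_recl //= bin0 muln1.
rewrite (eq_bigr (fun k => nchain p k.+2 * 'C(m, k.+1) + nchain p k.+2 * 'C(m, k))); last first.
  by move=> k _; rewrite binS mulnDr.
rewrite big_split /= addnA; congr (_ + _); last first.
  by apply: eq_bigr => k _; rewrite nchainS // big_distrl.
rewrite [LHS]addnC big_nat_recr //= bin_small // muln0 addn0 addnC.
by rewrite [RHS]big_nat_recl //= bin0 muln1.
Qed.

(** Over all [A \subset B] the powers sum to [x.+1 ^ #|B|]; [A = set0], which gives no interval,
    accounts for the second sum. *)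
Lemma sum_ilen x :
  \sum_(p | is_interval D p) x ^ ilen p + \sum_(F in D) x ^ #|F|
  = \sum_(F in D) x.+1 ^ #|F|.
Proof.
transitivity (\sum_(A : {set T} | A != set0) \sum_(B in D | A \subset B) x ^ #|B :\: A|
   + \sum_(F in D) x ^ #|F|).
  congr (_ + _); rewrite pair_big_dep; apply: eq_bigl => -[A B].
  by rewrite /is_interval /= [(B \in D) && _]andbC.
rewrite (exchange_big_dep (mem D)) /=; last by move=> A B _ /andP[].
rewrite -big_split; apply: eq_bigr => B BD.
have <- : \sum_(A : {set T} | (set0 \subset A) && (A \subset B))
   1 ^ #|A :\: set0| * x ^ #|B :\: A| = x.+1 ^ #|B|.
  by rewrite sum_between ?sub0set // setD0 add1n.
rewrite [in RHS](bigD1 set0) /= ?sub0set // setD0 exp1n mul1n addnC; congr (_ + _); first by rewrite setD0.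
by apply: eq_big => A; rewrite ?sub0set ?BD ?exp1n ?mul1n //= andbC.
Qed.

Lemma ilen_lt p : is_interval D p -> ilen p < cdim D.
Proof.
case/and3P => p0 sp pD; apply: leq_trans (leq_cdim pD).
by rewrite /ilen cardsDS //; have := subset_leq_card sp; move: p0; rewrite -card_gt0; lia.
Qed.

Lemma lt_ilen p q : p.1 \subset p.2 -> q.1 \subset q.2 -> le p q -> ilen p = ilen q -> p = q.
Proof.
move=> sp sq /andP[s1 s2] eq_len; apply: le_int_anti; rewrite /interval_le ?s1 ?s2 //.
have L1 := subset_leq_card s1; have L2 := subset_leq_card s2.
have L3 := subset_leq_card sp; have L4 := subset_leq_card sq.
move: eq_len; rewrite /ilen !cardsDS // => eq_len.
have /eqP -> : q.1 == p.1 by rewrite eqEcard s1 /=; lia.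
have /eqP -> : p.2 == q.2 by rewrite eqEcard s2 /=; lia.
by rewrite !subxx.
Qed.

(** Along a chain the lengths [ilen] are distinct, and they are below [cdim D]. *)
Lemma card_Int_le C : C \in Int D -> #|C| <= cdim D.
Proof.
move=> /IntP[intC totC]; case def_d : (cdim D) => [|d].
  rewrite leqn0 cards_eq0; apply/eqP/setP => p; rewrite inE; apply/negP => /intC/ilen_lt.
  by rewrite def_d.
rewrite -[d.+1]card_ord -(card_in_imset (f := fun p => inord (ilen p) : 'I_d.+1)).
  exact: max_card.
move=> p q pC qC /(congr1 val) /=; rewrite !inordK -?def_d ?ilen_lt ?intC // => eq_len.
have sub r : r \in C -> r.1 \subset r.2 by case/intC/and3P.
case/orP: (totC p q pC qC) => [Hpq|Hqp]; first by apply: lt_ilen => //; apply: sub.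
by apply/esym/lt_ilen => //; apply: sub.
Qed.

(** The upper end is shrunk by one element at a time. *)
Lemma long_chain p : is_interval D p ->
  exists C, [/\ C \in Int D, is_max p C & #|C| = (ilen p).+1].
Proof.
move def_n : (ilen p) => n; elim: n p def_n => [|n IH] p len_p Ip.
  have : 0 < nchain p 1 by rewrite nchain1.
  by case/card_gt0P => C; rewrite inE => /and3P[IC maxC /eqP cC]; exists C.
have /card_gt0P[x xp] : 0 < #|p.2 :\: p.1| by rewrite -/(ilen p) len_p.
pose q := (p.1, p.2 :\ x); move: (xp); rewrite inE => /andP[xp1 xp2].
have leqp : le q p by rewrite /interval_le subxx subD1set.
have Iq : is_interval D q.
  by apply: (is_interval_le Ip leqp); rewrite subsetD1 xp1 andbT; case/and3P: Ip.
have len_q : ilen q = n.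
  rewrite /ilen /=; have -> : p.2 :\ x :\: p.1 = (p.2 :\: p.1) :\ x.
    by apply/setP => y; rewrite !inE; case: (y == x); rewrite ?andbF.
  by move: len_p; rewrite /ilen (cardsD1 x) xp add1n => -[].
have : 0 < nchain p n.+2.
  rewrite nchainS // (bigD1 q) /=; last first.
    by rewrite Iq /lt_int leqp; apply/eqP => eq_qp; move: len_p; rewrite -eq_qp len_q; lia.
  rewrite addn_gt0; apply/orP; left; apply/card_gt0P.
  by case: (IH q len_q Iq) => C [IC maxC cC]; exists C; rewrite inE IC maxC cC eqxx.
by case/card_gt0P => C; rewrite inE => /and3P[IC maxC /eqP cC]; exists C.
Qed.

Lemma cdim_Int : cdim (Int D) = cdim D.
Proof.
apply/eqP; rewrite eqn_leq; apply/andP; split.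
  by apply/bigmax_leqP => C; apply: card_Int_le.
have /(eq_bigmax_cond (fun F : {set T} => #|F|)) : 0 < #|D|.
  by apply/card_gt0P; exists set0; case: complexD.
case=> F FD; rewrite -/(cdim D) => def_d; case cF : #|F| => [|n]; first by rewrite def_d cF.
have /card_gt0P[x xF] : 0 < #|F| by rewrite cF.
(* The interval from a vertex to a largest face has length [#|F| - 1], so a long chain below it has
   [#|F|] elements. *)
have Ip : is_interval D ([set x], F).
  by rewrite /is_interval /= -card_gt0 cards1 sub1set xF.
case: (long_chain Ip) => C [IC _ cC]; rewrite def_d; apply: leq_trans (leq_cdim IC).
by rewrite cC /ilen /= cardsDS ?sub1set // cards1; lia.
Qed.

End IntervalChains.

(** For [m > 0], [nchain_sum] turns the left side into the sum of [(2m - 1)^(ilen p)], which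
    [sum_ilen] evaluates. For [m = 0] only the empty chain and the empty face contribute. *)
Lemma Int_series (T : finType) (D : {set {set T}}) m : simplicial_complex D ->
  \sum_(0 <= i < (cdim (Int D)).+1) (fnum (Int D) i)%:R * (gbin m i)%:R
  = sdiff (fun m => fval D m%:R) m.*2.
Proof.
move=> complexD.
have castf n : fval D n%:R = (\sum_(F in D) n ^ #|F|)%N%:R.
  by rewrite natr_sum; apply: eq_bigr => F _; rewrite natrX.
case: m => [|m].
  rewrite big_nat_recl //= mulr1 big1 ?addr0 => [|i _]; last by rewrite mulr0.
  rewrite /sdiff subr0 /fval (bigD1 set0) /=; last by case: complexD.
  rewrite cards0 expr0 big1 ?addr0 => [|F /andP[_ F0]].
    rewrite /fnum; have -> : [set F in Int D | #|F| == 0%N] = [set set0].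
      apply/setP => C; rewrite [LHS]inE in_set1 cards_eq0; case: eqP => [->|]; rewrite ?andbF //.
      by rewrite andbT; apply/IntP; split=> p; rewrite ?inE // => q; rewrite inE.
    by rewrite cards1.
  by rewrite expr0n cards_eq0 (negbTE F0).
rewrite big_nat_recl //= mulr0 add0r /sdiff doubleS /= !castf -sum_ilen // natrD addrK.
under eq_bigr do rewrite -natrM; rewrite -natr_sum; congr (_%:R).
pose F k := (fnum (Int D) k.+1 * 'C(m, k))%N.
have cut a b : (a <= b)%N -> (forall k, (a <= k)%N -> F k = 0%N) ->
   (\sum_(0 <= k < b) F k = \sum_(0 <= k < a) F k)%N.
  move=> le_ab F0; rewrite (big_cat_nat (n := a)) //= [X in (_ + X)%N]big_nat_cond.
  by rewrite [X in (_ + X)%N]big1 ?addn0 // => k /andP[/andP[? _] _]; apply: F0.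
set e := cdim (Int D).
(* Both ranges are extended to a common one: chains have at most [e] elements, and ['C(m, k)]
   vanishes for [k > m]. *)
transitivity (\sum_(0 <= k < e + m.+1) F k)%N.
  rewrite (cut e) // ?leq_addr // => k le_k; rewrite /F /fnum.
  rewrite (_ : [set _ in _ | _] = set0) ?cards0 //; apply/eqP; rewrite -subset0.
  apply/subsetP => C; rewrite inE => /andP[/leq_cdim le_C /eqP cC].
  by move: le_C; rewrite cC -/e; lia.
rewrite (cut m.+1) ?leq_addl // => [|k lt_mk]; last by rewrite /F bin_small ?muln0.
rewrite /F; under eq_bigr do rewrite fnum_Int // big_distrl.
by rewrite exchange_big; apply: eq_bigr => p Ip; rewrite nchain_sum.
Qed.

Lemma hpoly_Int (T : finType) (D : {set {set T}}) k : simplicial_complex D ->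
  (hpoly (Int D))`_k =
  ((1 + 'X) ^+ cdim D * \sum_(0 <= i < (cdim D).+1) (hpoly D)`_i *: eulerian (cdim D) i)`_k.*2.
Proof.
move=> complexD; rewrite coef_hpoly eulerian_even_series cdim_Int //; apply: eq_sdiff => m.
rewrite -{1}(cdim_Int complexD) Int_series //; apply: (@eq_sdiff 1) => j.
by rewrite fval_hpoly natr1.
Qed.

(** * The gamma-vector of the interval subdivision *)

Lemma sum_even (V : nmodType) (F : nat -> V) n : (forall s, odd s -> F s = 0) ->
  \sum_(0 <= s < n.+1) F s = \sum_(0 <= r < n./2.+1) F r.*2.
Proof.
move=> F0; elim: n => [|n IH]; first by rewrite !big_nat1.
rewrite big_nat_recr //= IH; have [odd_n|ev_n] := boolP (odd n).
  have -> : uphalf n = n./2.+1 by lia.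
  by rewrite [in RHS]big_nat_recr //=; congr (_ + F _); lia.
by rewrite F0 //= ?addr0; congr bigop; rewrite /index_iota; congr iota; lia.
Qed.

Lemma coef_even_XnD s n k :
  ('X^s * (1 + 'X^2) ^+ n : {poly int})`_k.*2 =
  if odd s then 0 else ('X^(s./2) * (1 + 'X) ^+ n)`_k.
Proof.
have comp r : ('X^r * (1 + 'X) ^+ n : {poly int}) \Po 'X^2 = 'X^(r.*2) * (1 + 'X^2) ^+ n.
  rewrite rmorphM rmorphXn rmorphXn rmorphD /= comp_polyX.
  by rewrite -polyC1 comp_polyC -exprM mul2n.
rewrite -{1}(odd_double_half s) exprD -mulrA -comp; case: (odd s).
  rewrite coefXnM coef_comp_poly_Xn //; case: k => // k; rewrite ifF ?ifF //; lia.
by rewrite mul1r coef_comp_poly_Xn // dvdn2 odd_double /= divn2 doubleK.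
Qed.

(** All coefficients are kept here; those of index [2r] will form the gamma-vector. *)
Definition even_gamma (d : nat) (g : {poly int}) : {poly int} :=
  \sum_(0 <= i < d./2.+1) g`_i *: ('X^i * (1 + 2 *: 'X) ^+ (d - i)).

(** [(1+t)^d t^i (1+t)^(d-2i) = t^i ((1+t^2) + 2t)^(d-i)] expands in the products
    [t^s (1+t^2)^(d-s)]. Only [s = 2r] contributes to the even part, giving [t^r (1+t)^(d-2r)] after
    [t^2 -> t]. *)
Lemma expand_even (d : nat) (g : {poly int}) k :
  ((1 + 'X) ^+ d * expand d g)`_k.*2 =
  (\sum_(0 <= r < d./2.+1)
     (even_gamma d g)`_r.*2 *: ('X^r * (1 + 'X) ^+ (d - r.*2)))`_k.
Proof.
have -> : (1 + 'X) ^+ d * expand d g =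
   \sum_(0 <= s < d.+1) (even_gamma d g)`_s *: ('X^s * (1 + 'X^2) ^+ (d - s)).
  under eq_bigr do rewrite /even_gamma coef_sum scaler_suml.
  rewrite exchange_big /expand mulr_sumr big_mkord; apply: eq_bigr => i _.
  have le_i : (i.*2 <= d)%N by have := ltn_ord i; lia.
  have le_id : (i <= d)%N by lia.
  have E : \sum_(0 <= s < d.+1) ('X^i * (1 + 2 *: 'X) ^+ (d - i))`_s *:
      ('X^s * (1 + 'X^2) ^+ (d - s)) = 'X^i * (1 + 'X^2 + 2%:~R * 'X) ^+ (d - i) :> {poly int}.
    rewrite -(homogenize 2 'X (1 + 'X^2 : {poly int}) le_id); apply: eq_bigr => s _.
    by rewrite mulrzl -scaler_int intz.
  under [in RHS]eq_bigr do rewrite coefZ -scalerA.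
  rewrite -scaler_sumr E -scalerAr mulrCA -exprD; congr (_ *: (_ * _)).
  have -> : 1 + 'X^2 + 2%:~R * 'X = (1 + 'X) ^+ 2 :> {poly int} by rewrite -[2%:~R]/2; ring.
  by rewrite -exprM; congr (_ ^+ _); lia.
rewrite !coef_sum sum_even => [|s odd_s]; last first.
  by rewrite coefZ coef_even_XnD odd_s mulr0.
by apply: eq_bigr => r _; rewrite !coefZ coef_even_XnD odd_double doubleK.
Qed.

Lemma gamma_Int (T : finType) (D : {set {set T}}) (g : {poly int}) :
  simplicial_complex D ->
  \sum_(0 <= i < (cdim D).+1) (hpoly D)`_i *: eulerian (cdim D) i = expand (cdim D) g ->
  gamma_vector (Int D) (mkseq (fun r => (even_gamma (cdim D) g)`_r.*2) (cdim D)./2.+1).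
Proof.
move=> complexD hD; split; rewrite size_mkseq cdim_Int //.
apply/polyP => k; rewrite hpoly_Int // hD expand_even big_mkord; congr (polyseq _)`_k.
by apply: eq_bigr => r _; rewrite nth_mkseq.
Qed.

(** * Iterated cones *)

Definition fpoly (V : finType) (X : {set {set V}}) : {poly int} := \sum_(F in X) 'X^#|F|.

Lemma coef_fpoly (V : finType) (X : {set {set V}}) k : (fpoly X)`_k = (fnum X k)%:R.
Proof.
rewrite /fpoly coef_sum /fnum -sum1_card natr_sum [RHS]big_mkcond [LHS]big_mkcond.
apply: eq_bigr => F _; rewrite inE coefXn eq_sym; case: (F \in X) => //=; by case: eqP.
Qed.

Section Cone.
Variable V : finType.
Implicit Types (X Z : {set {set V}}) (F : {set V}) (G : {set option V}).

(* [X] together with the cone over [Z] with apex [None]. *)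
Definition cone X Z : {set {set option V}} :=
  [set G : {set option V} | Some @^-1: G \in (if None \in G then Z else X)].

Definition down_closed (W : finType) (Y : {set {set W}}) :=
  forall F G : {set W}, F \in Y -> G \subset F -> G \in Y.

Lemma down_cone X Z : down_closed X -> down_closed Z -> Z \subset X -> down_closed (cone X Z).
Proof.
move=> dX dZ sZX F G; rewrite !inE => FY sGF.
have sGF' : Some @^-1: G \subset Some @^-1: F by apply: preimsetS.
case: ifP => NG; first by rewrite (subsetP sGF _ NG) in FY; apply: dZ FY sGF'.
by case: ifP FY => _ FY; apply: dX sGF' => //; apply: (subsetP sZX).
Qed.

Lemma preim_some F : Some @^-1: (Some @: F) = F.
Proof. by apply/setP => v; rewrite inE mem_imset //; apply: Some_inj. Qed.

Lemma None_notin_some F : None \notin Some @: F.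
Proof. by apply/imsetP => -[]. Qed.

Lemma preim_someU F : Some @^-1: (None |: Some @: F) = F.
Proof. by apply/setP => v; rewrite !inE /= mem_imset //; apply: Some_inj. Qed.

Lemma some_preim G : Some @: (Some @^-1: G) = G :\ None.
Proof.
apply/setP => -[v|]; first by rewrite mem_imset ?inE //; apply: Some_inj.
by rewrite !inE eqxx (negbTE (None_notin_some _)).
Qed.

Lemma fpoly_cone X Z : fpoly (cone X Z) = fpoly X + 'X * fpoly Z.
Proof.
rewrite /fpoly (bigID (fun G => None \in G)) /= addrC; congr (_ + _).
  rewrite (reindex_onto (fun F => Some @: F) (fun G => Some @^-1: G)) /=; last first.
    by move=> G /andP[_ NG]; rewrite some_preim; apply/setDidPl; rewrite disjoint_sym disjoints1.
  apply: eq_big => F; last by rewrite card_imset //; apply: Some_inj.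
  by rewrite inE preim_some eqxx (negbTE (None_notin_some _)) !andbT.
rewrite (reindex_onto (fun F => None |: Some @: F) (fun G => Some @^-1: G)) /=; last first.
  by move=> G /andP[_ NG]; rewrite some_preim setD1K.
rewrite mulr_sumr; apply: eq_big => F.
  by rewrite inE preim_someU eqxx setU11 !andbT.
by move=> _; rewrite cardsU1 None_notin_some card_imset -?exprS //; apply: Some_inj.
Qed.

Lemma cone_mono X X' Z Z' : X \subset X' -> Z \subset Z' -> cone X Z \subset cone X' Z'.
Proof.
move=> sX sZ; apply/subsetP => G; rewrite !inE.
by case: ifP => _; apply: (subsetP _).
Qed.
End Cone.

(* [e] is the pair of the f-polynomial and a strict bound on the colours in use. *)
Definition colored (V : finType) (col : V -> nat) (X : {set {set V}})
    (e : {poly int} * nat) : Prop :=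
  [/\ simplicial_complex X, fpoly X = e.1,
      (forall F, F \in X -> {in F &, injective col}) &
      (forall F v, F \in X -> v \in F -> col v < e.2)%N].

(** The apex takes colour [c.-1], which does not occur in [Z] because colours there are below
    [c' <= c.-1]. *)
Lemma colored_cone (V : finType) (col : V -> nat) X Z p q c c' :
  colored col X (p, c) -> colored col Z (q, c') -> Z \subset X -> (c' < c)%N ->
  colored (oapp col c.-1) (cone X Z) (p + 'X * q, c).
Proof.
case=> [[X0 dX] fX iX bX] [[Z0 dZ] fZ iZ bZ] sZX lt_c; split=> /=.
- split; last exact: down_cone.
  by rewrite inE in_set0 (_ : _ @^-1: _ = set0) //; apply/setP => v; rewrite !inE.
- by rewrite fpoly_cone fX fZ.
- move=> G; rewrite inE => XG [v|] [w|] //= vG wG eq_vw.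
  + congr Some; case: ifP XG => _ XG; [apply: (iZ _ XG)|apply: (iX _ XG)] => //;
      by rewrite inE.
  + rewrite wG in XG; have := bZ _ v XG; rewrite inE vG eq_vw /= => /(_ isT); lia.
  + rewrite vG in XG; have := bZ _ w XG; rewrite inE wG -eq_vw /= => /(_ isT); lia.
- move=> G [v|] /=; rewrite inE; last by lia.
  case: ifP => _ XG vG; [apply: ltn_trans lt_c; apply: (bZ _ _ XG)|apply: (bX _ _ XG)];
    by rewrite inE.
Qed.

(** A cone over the family without any face adds nothing; it only moves [X] to the larger vertex
    type. *)
Lemma colored_lift (V : finType) (col : V -> nat) X a e :
  colored col X e -> colored (oapp col a) (cone X set0) e.
Proof.
case=> [[X0 dX] fX iX bX]; have d0 : down_closed (set0 : {set {set V}}).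
  by move=> F G; rewrite in_set0.
split=> /=.
- split; last by apply: down_cone; rewrite ?sub0set.
  by rewrite inE in_set0 (_ : _ @^-1: _ = set0) //; apply/setP => v; rewrite !inE.
- by rewrite fpoly_cone fX /fpoly big_set0 mulr0 addr0.
- move=> G; rewrite inE; case: ifP => NG; rewrite ?in_set0 // => XG [v|] [w|] //=;
    rewrite ?NG // => vG wG eq_vw.
  by congr Some; apply: (iX _ XG) => //; rewrite inE.
- move=> G [v|] /=; rewrite inE; case: ifP => NG; rewrite ?in_set0 ?NG // => XG vG.
  by apply: (bX _ _ XG); rewrite inE.
Qed.

(* The list describes nested complexes, largest first, by f-polynomial and colour bound. *)
Inductive chain : seq ({poly int} * nat) -> Prop :=
| chain_base : chain [:: (1, 0%N)]
| chain_color p c c' L : chain ((p, c) :: L) -> (c <= c')%N ->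
    chain [:: (p, c'), (p, c) & L]
| chain_cone p c q c' L : chain ((p, c) :: L) -> (q, c') \in (p, c) :: L -> (c' < c)%N ->
    chain [:: (p + 'X * q, c), (p, c) & L].

(** Inclusions require one vertex type for the whole list, so a cone step transports the older
    complexes by [colored_lift]. *)
Lemma chain_realize L : chain L ->
  exists (V : finType) (col : V -> nat) (Y : seq {set {set V}}),
    size Y = size L /\
    forall i, (i < size L)%N ->
      colored col (nth set0 Y i) (nth (0, 0%N) L i) /\ nth set0 Y i \subset nth set0 Y 0.
Proof.
elim=> {L} [|p c c' L _ [V [col [Y [sY HY]]]] le_c|p c q c' L _ [V [col [Y [sY HY]]]] qL lt_c].
- exists void, (fun _ => 0%N), [:: [set set0]]; split=> // -[] // _; split=> //=; split.
  + split; first by rewrite in_set1.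
    by move=> F G; rewrite !in_set1 => /eqP-> ; rewrite subset0.
  + by rewrite /fpoly big_set1 cards0.
  + by move=> F _ [].
  + by move=> F [].
- exists V, col, (nth set0 Y 0 :: Y); split; first by rewrite /= sY.
  case=> [_|i lt_i] /=; last exact: HY.
  split=> //; case: (HY 0%N isT) => -[H1 H2 H3 H4] _; split=> // F v XF vF.
  by apply: leq_trans (H4 F v XF vF) le_c.
- have [j lt_j eq_j] : exists2 j, (j < size ((p, c) :: L))%N & nth (0, 0%N) ((p, c) :: L) j = (q, c').
    by exists (index (q, c') ((p, c) :: L)); rewrite ?index_mem ?nth_index.
  have [colX _] := HY 0%N isT; have [colZ sZX] := HY j lt_j; rewrite eq_j in colZ.
  set X := nth set0 Y 0 in colX sZX HY; set Z := nth set0 Y j in colZ sZX.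
  exists (option V), (oapp col c.-1), (cone X Z :: [seq cone X' set0 | X' <- Y]).
  split; first by rewrite /= size_map sY.
  case=> [_|i lt_i]; first by split=> //; apply: colored_cone colX colZ sZX lt_c.
  have [colY sYX] := HY i lt_i; rewrite [nth set0 (_ :: _) i.+1]/= [nth _ (_ :: _) 0]/=.
  rewrite (nth_map set0) ?sY //; split; first exact: colored_lift.
  by apply: cone_mono => //; apply: sub0set.
Qed.

(** * Gamma-polynomials as f-polynomials of iterated cones *)

Definition cone_sum (L : seq ({poly int} * nat)) (c : nat) (r : {poly int}) : Prop :=
  exists qs : seq {poly int}, r = 'X * \sum_(q <- qs) q /\
    forall q, q \in qs -> exists2 c', (q, c') \in L & (c' < c)%N.

Lemma cone_sum0 L c : cone_sum L c 0.
Proof. by exists [::]; rewrite big_nil mulr0. Qed.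

Lemma cone_sum1 L c q c' : (q, c') \in L -> (c' < c)%N -> cone_sum L c ('X * q).
Proof.
by move=> qL lt_c; exists [:: q]; rewrite big_seq1; split=> // r /[!inE] /eqP->; exists c'.
Qed.

Lemma cone_sumD L c r s : cone_sum L c r -> cone_sum L c s -> cone_sum L c (r + s).
Proof.
case=> [qs [-> Hqs]] [qs' [-> Hqs']]; exists (qs ++ qs'); rewrite big_cat mulrDr.
by split=> // q; rewrite mem_cat => /orP[/Hqs|/Hqs'].
Qed.

Lemma cone_sumMn L c r k : cone_sum L c r -> cone_sum L c (r *+ k).
Proof.
by move=> Hr; elim: k => [|k IH]; [apply: cone_sum0|rewrite mulrS; apply: cone_sumD].
Qed.

Lemma cone_sum_big L c (F : nat -> {poly int}) a b :
  (forall i, (a <= i < b)%N -> cone_sum L c (F i)) -> cone_sum L c (\sum_(a <= i < b) F i).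
Proof.
move=> H; rewrite big_nat_cond; apply: (big_ind (cone_sum L c)).
- exact: cone_sum0.
- exact: cone_sumD.
- by move=> i /andP[Hi _]; apply: H.
Qed.

(** The cones are attached one at a time. Every base belongs to the original list, so no face
    contains two of the new apexes and all of them can share a colour. *)
Lemma chain_add p c L r : chain ((p, c) :: L) -> cone_sum ((p, c) :: L) c r ->
  exists L', chain ((p + r, c) :: L') /\ {subset (p, c) :: L <= (p + r, c) :: L'}.
Proof.
move=> chL [qs [-> Hqs]]; elim: qs p L chL Hqs => [|q qs IH] p L chL Hqs.
  by exists L; rewrite big_nil mulr0 addr0; split.
have [c' qL lt_c] := Hqs q (mem_head _ _).
have [] := IH _ _ (chain_cone chL qL lt_c).
  move=> q' q'qs; have [|c'' q'L lt_c''] := Hqs q'; first by rewrite inE q'qs orbT.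
  by exists c''; rewrite // inE q'L orbT.
move=> L' []; rewrite big_cons mulrDr -addrA => chL' sL'; exists L'; split=> // e eL.
by apply: sL'; rewrite inE eL orbT.
Qed.

(* The complexes with f-polynomials [gamQ n k] are nested, for (n, k) in lexicographic
   order; [gamB n i] with i > 0 is what the step from [gamQ n i] adds, and is a sum
   of cones over complexes of levels below n - 1. *)
Definition gamB n i := \sum_(i <= j < n./2.+1) gamA n j.
Definition gamQ n k := \sum_(0 <= i < k) gamB n i.

(** [k = 0] is left out because [gamQ m 0] is 0, whereas every complex has the empty face. *)
Definition has_levels (L : seq ({poly int} * nat)) n :=
  forall m k, (m < n)%N -> (0 < k <= m./2.+1)%N -> (gamQ m k, m) \in L.

(** Unfolding the recursion down to [gamT 0 = 0] leaves only terms [2 X * gamQ m k] of lower levels,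
    each a pair of cones or zero. *)
Lemma cone_sum_gamT L N c n i : has_levels L N -> (N <= c)%N -> (n <= N)%N ->
  (i <= n.+1./2)%N -> cone_sum L c (\sum_(0 <= j < i) gamT n j).
Proof.
move=> HL le_Nc; elim: n i => [|n IH] i le_nN le_i.
  by rewrite big1 //; exact: cone_sum0.
have -> : \sum_(0 <= j < i) gamT n.+1 j =
   \sum_(0 <= j < i) \sum_(0 <= k < j) gamT n k + ('X * gamQ n i) *+ 2.
  rewrite (eq_bigr _ (fun j _ => gamTS n j)) big_split -scaler_sumr scaler_nat.
  by rewrite -mulr_sumr.
apply: cone_sumD; first by apply: cone_sum_big => j Hj; apply: IH; lia.
case: i le_i => [|i] le_i.
  by rewrite /gamQ big_geq // mulr0 mul0rn; apply: cone_sum0.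
by apply/cone_sumMn/(cone_sum1 (c' := n)); [apply: HL; lia|lia].
Qed.

(** [0 < i] keeps out [gamA n 0], which has constant term 1; everything else reduces to sums of
    [gamT]. *)
Lemma cone_sum_gamA L N c n i : has_levels L N -> (N <= c)%N -> (n <= N.+1)%N ->
  (0 < i <= n./2)%N -> cone_sum L c (gamA n i).
Proof.
move=> HL le_Nc; elim: n i => [|n IH] i le_nN Hi; first by lia.
rewrite gamAS; apply: cone_sumD; last by apply: cone_sum_big => j Hj; apply: IH; lia.
have H := cone_sum_gamT HL le_Nc (le_nN : (n <= N)%N) (i := i).
by case: eqP => _; rewrite ?scale1r ?scaler_nat; [|apply: cone_sumMn]; apply: H; lia.
Qed.

(** Passage from the end of level [n] to the start of level [n.+1]. For odd [n] the index
    [n.+1./2.+1] exceeds [n./2.+1] by one, but the extra summand is an empty sum. *)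
Lemma gamQS n : gamQ n.+1 1 = gamQ n n.+1./2.+1 +
  \sum_(0 <= i < n.+1./2.+1) (if i.*2 == n.+1 then 1 else 2) *: \sum_(0 <= j < i) gamT n j.
Proof. by rewrite /gamQ big_nat1 addrC -big_split. Qed.

Lemma has_levels_sub L L' n : has_levels L n -> {subset L <= L'} -> has_levels L' n.
Proof. by move=> HL sL m k Hm Hk; apply/sL/HL. Qed.

(** Within level [n] the steps [gamB n i] with [i > 0] are added using lower levels only; then a new
    colour is allowed and the [gamT] sums of [gamQS] lead to level [n.+1]. *)
Lemma chain_levels n :
  exists L, chain ((gamQ n 1, n) :: L) /\ has_levels ((gamQ n 1, n) :: L) n.
Proof.
elim: n => [|n [L [chL HL]]].
  by exists [::]; split; [rewrite /gamQ /gamB !big_nat1; exact: chain_base|].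
have [L1 [chL1 HL1 HQ]] : exists L1, [/\ chain ((gamQ n n.+1./2.+1, n) :: L1),
    has_levels ((gamQ n n.+1./2.+1, n) :: L1) n &
    forall k, (0 < k <= n.+1./2.+1)%N -> (gamQ n k, n) \in (gamQ n n.+1./2.+1, n) :: L1].
  elim: (n.+1./2) => [|K [L1 [chL1 HL1 HQ]]].
    exists L; split=> // k Hk; have -> : k = 1%N by lia.
    by rewrite mem_head.
  have [|L2 [chL2 sL2]] := chain_add (r := gamB n K.+1) chL1.
    by apply: cone_sum_big => j Hj; apply: (cone_sum_gamA HL1); lia.
  have defQ : gamQ n K.+2 = gamQ n K.+1 + gamB n K.+1 by rewrite /gamQ big_nat_recr.
  exists L2; rewrite defQ; split=> //; first exact: has_levels_sub sL2.
  move=> k Hk; case: (leqP k K.+1) => [le_k|lt_k]; first by apply/sL2/HQ; lia.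
  by have -> : k = K.+2 by [lia]; rewrite defQ mem_head.
have {}HL1 : has_levels [:: (gamQ n n.+1./2.+1, n.+1), (gamQ n n.+1./2.+1, n) & L1] n.+1.
  move=> m k Hm Hk; rewrite inE; apply/orP; right.
  case: (ltnP m n) => [lt_mn|le_nm]; first exact: HL1.
  by have -> : m = n by [lia]; apply: HQ; lia.
have [|L2 [chL2 sL2]] := chain_add (r := \sum_(0 <= i < n.+1./2.+1)
    (if i.*2 == n.+1 then 1 else 2) *: \sum_(0 <= j < i) gamT n j) (chain_color chL1 (leqnSn n)).
  apply: cone_sum_big => i Hi; have H := cone_sum_gamT HL1 (leqnn _) (leqnSn n) (i := i).
  by case: eqP => _; rewrite ?scale1r ?scaler_nat; [|apply: cone_sumMn]; apply: H; lia.
by exists L2; rewrite gamQS; split=> //; apply: has_levels_sub HL1 sL2.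
Qed.

(** As [h 0 = 1], the construction starts from [gamA d 0], which is [gamQ d.-1 1] for [d > 0]; the
    other terms are cones, taken [h i] times. *)
Lemma colored_gamma d (h : nat -> int) : h 0%N = 1 -> (forall i, 0 <= h i) ->
  exists (V : finType) (col : V -> nat) (X : {set {set V}}),
    colored col X (\sum_(0 <= i < d./2.+1) h i *: gamA d i, d).
Proof.
move=> h0 h_ge0.
suff [L chL] : exists L, chain ((\sum_(0 <= i < d./2.+1) h i *: gamA d i, d) :: L).
  have [V [col [Y [sY /(_ 0%N isT) [H _]]]]] := chain_realize chL.
  by exists V, col, (nth set0 Y 0).
case: d => [|n]; first by exists [::]; rewrite big_nat1 h0 scale1r; exact: chain_base.
have [L [chL HL]] := chain_levels n.
rewrite big_nat_recl // h0 scale1r.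
have -> : gamA n.+1 0 = gamQ n 1.
  by rewrite gamAS [\sum_(0 <= j < 0) _]big_geq // scaler0 add0r /gamQ big_nat1.
have HL' : has_levels [:: (gamQ n 1, n.+1), (gamQ n 1, n) & L] n.
  by apply: has_levels_sub HL _ => e eL; rewrite inE eL orbT.
have [|L' [chL' _]] := chain_add (r := \sum_(0 <= i < n.+1./2) h i.+1 *: gamA n.+1 i.+1)
   (chain_color chL (leqnSn n)); last by exists L'.
apply: cone_sum_big => i Hi; rewrite -[h _]gez0_abs // -natz scaler_nat; apply: cone_sumMn.
by apply: (cone_sum_gamA HL'); lia.
Qed.

(** * Two new vertices for each colour *)

Lemma sum_subsets (I : finType) (S : {set I}) :
  \sum_(B : {set I} | B \subset S) 'X^#|B| = (1 + 'X) ^+ #|S| :> {poly int}.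
Proof.
rewrite (eq_bigl (fun B => B \in powerset S)) => [|B]; last by rewrite powersetE.
rewrite (sum_by_card (fun i => 'X^i : {poly int}) (n := #|S|.+1)); last first.
  by move=> B; rewrite powersetE ltnS; apply: subset_leq_card.
rewrite exprDn big_mkord; apply: eq_bigr => i _; rewrite expr1n mul1r /fnum -cards_draws.
by congr (_ *+ #|pred_of_set _|); apply/setP => B; rewrite !inE.
Qed.

Section FillColors.
Variables (V : finType) (col : V -> nat) (X : {set {set V}}) (p : {poly int}) (d : nat).
Hypothesis colX : colored col X (p, d).
Implicit Types (s : {set V}) (t : {set 'I_d}) (F : {set V + 'I_d}).

Definition free_colors s : {set 'I_d} := [set c : 'I_d | [forall v in s, col v != c]].

(** One new vertex per colour; the construction is applied twice. *)
Definition fill : {set {set V + 'I_d}} :=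
  [set F : {set V + 'I_d} | (inl @^-1: F \in X) && (inr @^-1: F \subset free_colors (inl @^-1: F))].

Definition fill_col (w : V + 'I_d) : nat := match w with inl v => col v | inr c => c end.

Lemma card_free_colors s : s \in X -> #|free_colors s| = (d - #|s|)%N.
Proof.
case: colX => /= _ _ iX bX sX; suff <- : #|~: free_colors s| = #|s|.
  by rewrite -[X in (X - _)%N](card_ord d) -(cardsC (free_colors s)) addnK.
have [->|[v0 v0s]] := set_0Vmem s.
  rewrite cards0; apply/eqP; rewrite cards_eq0 -subset0; apply/subsetP => c.
  by rewrite !inE => /negP[]; apply/forall_inP => v; rewrite inE.
(* Default value for [insubd]; it exists because [s] is nonempty, while [d] could otherwise be 0. *)
pose c0 : 'I_d := Ordinal (bX _ _ sX v0s).
rewrite -(card_in_imset (f := fun v => insubd c0 (col v))) => [|v w vs ws]; last first.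
  move/(congr1 val); rewrite !val_insubd !(bX s) //; exact: (iX _ sX).
apply: eq_card => c; rewrite !inE; apply/forall_inPn/imsetP => [[v vs /negPn/eqP cv]|[v vs ->]].
  by exists v => //; apply/val_inj; rewrite val_insubd cv ltn_ord.
by exists v => //; rewrite negbK val_insubd (bX s).
Qed.

Definition glue (x : {set V} * {set 'I_d}) : {set V + 'I_d} := (inl @: x.1) :|: (inr @: x.2).

Lemma inl_glue x : inl @^-1: glue x = x.1.
Proof.
apply/setP => v; rewrite !inE mem_imset; last by move=> a b [].
by rewrite orbC; case: imsetP => [[]|].
Qed.

Lemma inr_glue x : inr @^-1: glue x = x.2.
Proof.
apply/setP => v; rewrite !inE [in X in _ || X]mem_imset; last by move=> a b [].
by case: imsetP => [[]|].
Qed.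

Lemma glueK F : glue (inl @^-1: F, inr @^-1: F) = F.
Proof.
apply/setP => -[v|c].
  transitivity (v \in inl @^-1: glue (inl @^-1: F, inr @^-1: F)); first by rewrite [RHS]inE.
  by rewrite inl_glue inE.
transitivity (c \in inr @^-1: glue (inl @^-1: F, inr @^-1: F)); first by rewrite [RHS]inE.
by rewrite inr_glue inE.
Qed.

Lemma card_glue x : #|glue x| = (#|x.1| + #|x.2|)%N.
Proof.
rewrite cardsU (_ : _ :&: _ = set0) ?cards0 ?subn0; last first.
  apply/setP => w; rewrite !inE; apply/negP => /andP[/imsetP[v _ ->]] /imsetP[] //.
by rewrite !card_imset // => a b [].
Qed.

Lemma fpoly_fill : fpoly fill = \sum_(F in X) 'X^#|F| * (1 + 'X) ^+ (d - #|F|).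
Proof.
rewrite /fpoly (reindex_onto glue (fun F => (inl @^-1: F, inr @^-1: F))) /=; last first.
  by move=> F _; apply: glueK.
transitivity (\sum_(s in X) \sum_(t : {set 'I_d} | t \subset free_colors s) 'X^(#|s| + #|t|) : {poly int}).
  rewrite pair_big_dep; apply: eq_big => x; last by rewrite card_glue.
  by rewrite inE inl_glue inr_glue -surjective_pairing eqxx andbT.
apply: eq_bigr => s sX; rewrite -card_free_colors // -sum_subsets mulr_sumr.
by apply: eq_bigr => t _; rewrite exprD.
Qed.

Lemma card_colored (F : {set V}) : F \in X -> (#|F| <= d)%N.
Proof.
move=> FX; case: colX => /= _ _ iX bX.
have [->|[v0 v0F]] := set_0Vmem F; first by rewrite cards0.
pose c0 : 'I_d := Ordinal (bX _ _ FX v0F).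
rewrite -[X in (_ <= X)%N](card_ord d) -(card_in_imset (f := fun v => insubd c0 (col v))) ?max_card //.
by move=> v w vF wF /(congr1 val); rewrite !val_insubd !(bX F) //; apply: (iX _ FX).
Qed.

Lemma colored_fill : colored fill_col fill
  (\sum_(0 <= i < d.+1) p`_i *: ('X^i * (1 + 'X) ^+ (d - i)), d).
Proof.
case: (colX) => /= -[X0 dX] fX iX bX.
have free_mono s s' : s \subset s' -> free_colors s' \subset free_colors s.
  move=> ss; apply/subsetP => c; rewrite !inE => /forall_inP H; apply/forall_inP => v vs.
  by apply/H/(subsetP ss).
split=> /=.
- split.
    rewrite inE (_ : inl @^-1: _ = set0) ?X0 /=; last by apply/setP => v; rewrite !inE.
    by rewrite (_ : inr @^-1: _ = set0) ?sub0set //; apply/setP => v; rewrite !inE.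
  move=> F G; rewrite !inE => /andP[FX sF] sGF; rewrite (dX _ _ FX) ?preimsetS //=.
  apply: subset_trans (preimsetS _ sGF) _; apply: subset_trans sF _.
  by apply/free_mono/preimsetS.
- rewrite fpoly_fill (sum_by_card (fun i => 'X^i * (1 + 'X) ^+ (d - i)) (n := d.+1)).
    by apply: eq_bigr => i _; rewrite -fX coef_fpoly scaler_nat.
  exact: card_colored.
- move=> F; rewrite inE => /andP[FX sF] [v|c] [w|c'] //= vF wF eq_vw.
  + by congr inl; apply: (iX _ FX); rewrite ?inE.
  + have : c' \in inr @^-1: F by rewrite inE.
    by move/(subsetP sF); rewrite inE => /forall_inP/(_ v); rewrite inE eq_vw eqxx => /(_ vF).
  + have : c \in inr @^-1: F by rewrite inE.
    by move/(subsetP sF); rewrite inE => /forall_inP/(_ w); rewrite inE eq_vw eqxx => /(_ wF).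
  + by congr inr; apply: val_inj.
- move=> F [v|c] //=; rewrite inE => /andP[FX _] vF.
  by apply: (bX _ _ FX); rewrite inE.
Qed.

(** All new vertices together form a face; it later fixes the dimension, so that the number of
    colours is exact. *)
Lemma full_face_fill : exists2 F, F \in fill & #|F| = d.
Proof.
exists (glue (set0, setT)); last by rewrite card_glue cards0 cardsT card_ord.
rewrite inE inl_glue inr_glue; case: colX => -[X0 _] _ _ _; rewrite X0 /=.
by apply/subsetP => c _; rewrite inE; apply/forall_inP => v; rewrite inE.
Qed.

End FillColors.

(** The second filling replaces [X^i (1 + X)^(d-i)] by [X^i ((1 + X) + X)^(d-i)]. *)
Lemma colored_even_gamma (V : finType) (col : V -> nat) (X : {set {set V}}) g d :
  colored col X (g, d) -> (size g <= d./2.+1)%N ->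
  exists (W : finType) (colW : W -> nat) (K : {set {set W}}),
    colored colW K (even_gamma d g, d) /\ exists2 F, F \in K & #|F| = d.
Proof.
move=> colX size_g; have colY := colored_fill colX.
have colK := colored_fill colY; have FK := full_face_fill colY.
do 3![eexists]; split; last exact: FK.
suff -> : even_gamma d g = \sum_(0 <= s < d.+1) (\sum_(0 <= i < d.+1)
   g`_i *: ('X^i * (1 + 'X) ^+ (d - i)))`_s *: ('X^s * (1 + 'X) ^+ (d - s)) by exact: colK.
under [in RHS]eq_bigr do rewrite coef_sum scaler_suml.
rewrite exchange_big /= (big_cat_nat (n := d./2.+1)) //=; last by lia.
rewrite [X in _ = _ + X]big_nat_cond [X in _ = _ + X]big1 ?addr0 => [|i]; last first.
  case/andP => /andP[le_i _] _; rewrite big1 // => s _.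
  by rewrite coefZ nth_default ?(leq_trans size_g) // mul0r scale0r.
apply: eq_big_nat => i Hi; under eq_bigr do rewrite coefZ -scalerA.
rewrite -scaler_sumr; congr (_ *: _).
have le_id : (i <= d)%N by lia.
have := homogenize 1 'X (1 + 'X : {poly int}) le_id.
rewrite mul1r -addrA -mulr2n -scaler_nat => <-; apply: eq_bigr => s _.
by rewrite scale1r mulrzl -scaler_int intz.
Qed.

(** * Pairing the faces of even size *)

Section Pairing.
Local Open Scope nat_scope.
Variables (W : finType) (col : W -> nat) (K : {set {set W}}).
Hypothesis complexK : simplicial_complex K.
Hypothesis colK : forall F, F \in K -> {in F &, injective col}.
Implicit Types (e : {set W}) (S : {set {set W}}).

Definition before e e' := [forall a in e, forall b in e', col a < col b].

Definition pairing : {set {set {set W}}} :=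
  [set S : {set {set W}} | [&& [forall e in S, #|e| == 2], cover S \in K &
     [forall e in S, forall e' in S, (e == e') || before e e' || before e' e]]].

Lemma beforeP e e' : reflect (forall a b, a \in e -> b \in e' -> col a < col b) (before e e').
Proof.
apply: (iffP forall_inP) => [H a b ae be|H a ae]; first exact: (forall_inP (H a ae)).
by apply/forall_inP => b; apply: H.
Qed.

Lemma pairingP S : reflect
  [/\ forall e, e \in S -> #|e| = 2, cover S \in K &
      forall e e', e \in S -> e' \in S -> e != e' -> before e e' \/ before e' e]
  (S \in pairing).
Proof.
rewrite inE; apply: (iffP and3P) => -[H1 H2 H3]; split=> //.
- by move=> e eS; apply/eqP/(forall_inP H1).
- move=> e e' eS e'S /negbTE ne; apply/orP.
  by have := forall_inP (forall_inP H3 e eS) e' e'S; rewrite ne.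
- by apply/forall_inP => e eS; apply/eqP/H1.
- apply/forall_inP => e eS; apply/forall_inP => e' e'S; rewrite -orbA.
  by case: eqVneq => //= ne; apply/orP/H3.
Qed.

Lemma cover_mono S S' : S' \subset S -> cover S' \subset cover S.
Proof.
move=> sS; apply/bigcupsP => e eS'; apply: (bigcup_max e) => //.
exact: (subsetP sS).
Qed.

Lemma sub_cover S e : e \in S -> e \subset cover S.
Proof. by move=> eS; apply: (bigcup_max e). Qed.

Lemma pairing_sub S S' : S \in pairing -> S' \subset S -> S' \in pairing.
Proof.
move=> /pairingP[H1 H2 H3] sS; have sub := subsetP sS; apply/pairingP; split.
- by move=> e /sub/H1.
- by apply: complexK.2 H2 _; apply: cover_mono.
- by move=> e e' /sub eS /sub e'S; apply: H3.
Qed.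

Lemma pairing_complex : simplicial_complex pairing.
Proof.
split; last by move=> S S'; apply: pairing_sub.
apply/pairingP; split=> [e||e e'].
- by rewrite inE.
- by rewrite /cover big_set0; case: complexK.
- by rewrite inE.
Qed.

Lemma pairing_disjoint S e e' w : S \in pairing -> e \in S -> e' \in S ->
  w \in e -> w \in e' -> e = e'.
Proof.
move=> /pairingP[_ _ H] eS e'S we we'; apply/eqP/negPn/negP => ne.
case: (H e e' eS e'S ne) => /beforeP bef.
  by have := bef w w we we'; rewrite ltnn.
by have := bef w w we' we; rewrite ltnn.
Qed.

Lemma card_cover_pairing S : S \in pairing -> #|cover S| = #|S|.*2.
Proof.
move=> GS; have /eqP <- : trivIset S.
  apply/trivIsetP => e e' eS e'S ne; rewrite -setI_eq0; apply/eqP/setP => w.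
  rewrite !inE; apply/negP => /andP[we we'].
  by rewrite (pairing_disjoint GS eS e'S we we') eqxx in ne.
case/pairingP: GS => H _ _; rewrite (eq_bigr (fun _ => 2)) ?sum_nat_const ?muln2 //.
Qed.

Lemma cover_D1 S e : S \in pairing -> e \in S -> cover (S :\ e) = cover S :\: e.
Proof.
move=> GS eS; apply/setP => w; rewrite inE; apply/bigcupP/andP.
  case=> e'; rewrite !inE => /andP[ne e'S] we'; split; last by apply/bigcupP; exists e'.
  by apply: contraNN ne => we; rewrite (pairing_disjoint GS eS e'S we we').
case=> we /bigcupP[e' e'S we']; exists e' => //; rewrite !inE e'S andbT.
by apply: contraNneq we => <-.
Qed.

Lemma min_color F : F != set0 -> exists2 a, a \in F & forall b, b \in F -> col a <= col b.
Proof.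
case/set0Pn => a0 a0F; case: (@arg_minnP _ a0 (mem F) col a0F) => a aF mina.
by exists a.
Qed.

(** In both pairings [a] must be matched with the vertex of next colour: if [b] lay outside [e'],
    the partner of [a] in [e'] would have a colour between those of [a] and [b], with no possible
    place in [S]. *)
Lemma pairing_first S S' e e' a : S \in pairing -> S' \in pairing -> cover S = cover S' ->
  e \in S -> e' \in S' -> a \in e -> a \in e' ->
  (forall b, b \in cover S -> col a <= col b) -> e \subset e'.
Proof.
move=> GS GS' eq_cov eS e'S ae ae' mina; apply/subsetP => b be.
have bS : b \in cover S by apply: (subsetP (sub_cover eS)).
have /bigcupP[f fS' bf] : b \in cover S' by rewrite -eq_cov.
have [->//|ne_fe'] := eqVneq e' f.
case/pairingP: (GS') => card2' _ sep'; case/pairingP: (GS) => card2 KS sep.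
have [bef|bef] := sep' e' f e'S fS' ne_fe'; last first.
  by have := mina b bS; rewrite leqNgt (beforeP _ _ bef b a).
(* the second element b' of e' lies in another pair of S, between a and b *)
have /eqP/cards2P[x [y [nxy def_e']]] := card2' _ e'S.
have [b' b'e' nb'a] : exists2 b', b' \in e' & b' != a.
  move: ae'; rewrite def_e' !inE => /orP[]/eqP->; [exists y|exists x];
    by rewrite ?inE ?eqxx ?orbT // eq_sym.
have b'S : b' \in cover S by rewrite eq_cov; apply: (subsetP (sub_cover e'S)).
have /bigcupP[f' f'S b'f'] := b'S.
have lt_b'b := beforeP _ _ bef b' b b'e' bf.
have lt_ab : col a < col b := beforeP _ _ bef a b ae' bf.
have [ef|ne_ef'] := eqVneq e f'.
  have : 2 < #|e|.
    rewrite (cardsD1 a) ae (cardsD1 b) !inE be (cardsD1 b') !inE ef b'f'.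
    have -> : b != a by apply: contraTneq lt_ab => ->; rewrite ltnn.
    have -> : b' != b by apply: contraTneq lt_b'b => ->; rewrite ltnn.
    by rewrite nb'a.
  by rewrite card2.
have [bef'|bef'] := sep e f' eS f'S ne_ef'.
  by have := beforeP _ _ bef' b b' be b'f'; rewrite ltnNge (ltnW lt_b'b).
by have := mina b' b'S; rewrite leqNgt (beforeP _ _ bef' b' a).
Qed.

(* By induction, as the pair containing the vertex of least colour is determined. *)
Lemma cover_inj S S' : S \in pairing -> S' \in pairing -> cover S = cover S' -> S = S'.
Proof.
move def_n : #|S| => n; elim: n S S' def_n => [|n IH] S S' cardS GS GS' eq_cov.
  move/eqP: cardS; rewrite cards_eq0 => /eqP S0; apply/esym/eqP.
  by rewrite S0 -cards_eq0 -double_eq0 -card_cover_pairing // -eq_cov S0 /cover big_set0 cards0.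
have cov0 : cover S != set0 by rewrite -cards_eq0 card_cover_pairing // cardS.
have [a aS mina] := min_color cov0.
have /bigcupP[e eS ae] := aS; have /bigcupP[e' e'S' ae'] : a \in cover S' by rewrite -eq_cov.
have eq_e : e = e'.
  apply/eqP; rewrite eqEsubset (pairing_first GS GS' eq_cov eS e'S' ae ae' mina) /=.
  apply: (pairing_first GS' GS (esym eq_cov) e'S' eS ae' ae) => b; rewrite -eq_cov.
  exact: mina.
rewrite -eq_e in e'S'; rewrite -(setD1K eS) -(setD1K e'S'); congr (_ |: _); apply: IH.
- by move: cardS; rewrite (cardsD1 e) eS add1n => -[].
- by apply: pairing_sub GS _; apply: subsetDl.
- by apply: pairing_sub GS' _; apply: subsetDl.
- by rewrite !cover_D1 // eq_cov.
Qed.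

(** The two vertices of least colour form the first pair. *)
Lemma cover_surj r F : F \in K -> #|F| = r.*2 -> exists2 S, S \in pairing & cover S = F.
Proof.
elim: r F => [|r IH] F FK cardF.
  exists set0; first by case: pairing_complex.
  by rewrite /cover big_set0; apply/esym/eqP; rewrite -cards_eq0 cardF.
have [|a aF mina] := @min_color F; first by rewrite -cards_eq0 cardF.
have cardFa : #|F :\ a| = r.*2.+1 by move: cardF; rewrite (cardsD1 a) aF => -[].
have [|b bFa minb] := @min_color (F :\ a); first by rewrite -cards_eq0 cardFa.
have cardF' : #|F :\ a :\ b| = r.*2 by move: cardFa; rewrite (cardsD1 b) bFa => -[].
move: (bFa); rewrite !inE => /andP[nba bF].
have sF' : F :\ a :\ b \subset F by rewrite !subDset !subsetU ?subxx ?orbT.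
have [S' GS' covS'] := IH _ (complexK.2 _ _ FK sF') cardF'.
have bef e : e \in S' -> before [set a; b] e.
  move=> eS'; apply/beforeP => x c xab ce.
  have : c \in F :\ a :\ b by rewrite -covS'; apply: (subsetP (sub_cover eS')).
  rewrite !inE => /and3P[ncb nca cF].
  have lt_bc : col b < col c.
    rewrite ltn_neqAle minb ?inE ?nca // andbT; apply: contraNneq ncb.
    by move/(colK FK bF cF)->.
  move: xab; rewrite !inE => /orP[]/eqP-> //; apply: leq_ltn_trans lt_bc.
  exact: mina.
case/pairingP: GS' => card2 KS' sep.
have covS : cover ([set a; b] |: S') = F.
  rewrite /cover bigcup_setU big_set1 -/(cover S') covS'; apply/setP => x; rewrite !inE.
  case: (eqVneq x a) => [->|_] /=; first by rewrite aF.
  by case: (eqVneq x b) => [->|_] //=; rewrite bF.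
exists ([set a; b] |: S') => //; apply/pairingP; split; last 1 first.
- move=> e e'; rewrite !inE => /orP[/eqP->|eS'] /orP[/eqP->|e'S'].
  + by rewrite eqxx.
  + by left; apply: bef.
  + by right; apply: bef.
  + exact: sep.
- by move=> e; rewrite !inE => /orP[/eqP->|/card2 //]; rewrite cards2 eq_sym nba.
- by rewrite covS.
Qed.

Lemma fnum_pairing r : fnum pairing r = fnum K r.*2.
Proof.
rewrite /fnum -(card_in_imset (f := cover)); last first.
  by move=> S S'; rewrite !in_set => /andP[GS _] /andP[GS' _]; apply: cover_inj;
     rewrite inE.
apply: eq_card => F; rewrite [RHS]inE; apply/imsetP/andP.
  case=> S; rewrite inE => /andP[GS /eqP cS] ->; rewrite card_cover_pairing // cS eqxx.
  by case/pairingP: GS.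
case=> FK /eqP cF; have [S GS covS] := cover_surj FK cF; exists S => //.
rewrite inE GS /=; apply/eqP/double_inj; by rewrite -card_cover_pairing // covS.
Qed.

(** Both vertices of a later pair have colours above the maximum of the earlier one, so the maxima
    differ by at least 2 and their halves stay distinct. The shift by one brings the values below
    [d./2]. *)
Definition pair_color e := (\max_(a in e) col a).-1./2.

Lemma pair_color_before S e e' : S \in pairing -> e \in S -> e' \in S -> before e e' ->
  pair_color e < pair_color e'.
Proof.
move=> /pairingP[card2 KS _] eS e'S /beforeP bef.
have maxP (f : {set W}) x : x \in f -> col x <= \max_(a in f) col a.
  by move=> xf; apply: (leq_bigmax_cond x).
have inj f x y : f \in S -> x \in f -> y \in f -> x != y -> col x != col y.
  move=> fS xf yf; apply: contraNneq => /(colK KS) -> //;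
    exact: (subsetP (sub_cover fS)).
have /eqP/cards2P[x [y [nxy def_e]]] := card2 e eS.
have /eqP/cards2P[x' [y' [nxy' def_e']]] := card2 e' e'S.
have [xe ye] : x \in e /\ y \in e by rewrite def_e !inE !eqxx orbT.
have [xe' ye'] : x' \in e' /\ y' \in e' by rewrite def_e' !inE !eqxx orbT.
have N1 := inj _ _ _ eS xe ye nxy; have N2 := inj _ _ _ e'S xe' ye' nxy'.
have /(eq_bigmax_cond col)[a ae maxa] : 0 < #|e| by rewrite card2.
move: (maxP _ _ xe) (maxP _ _ ye) (maxP _ _ xe') (maxP _ _ ye') N1 N2.
move: (bef a x' ae xe') (bef a y' ae ye'); rewrite /pair_color maxa.
move: (\max_(_ in _) _) (col x) (col y) (col x') (col y') (col a) => *; lia.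
Qed.

Lemma pair_color_inj S : S \in pairing -> {in S &, injective pair_color}.
Proof.
move=> GS e e' eS e'S eq_c; apply/eqP/negPn/negP => ne; case/pairingP: (GS) => _ _ sep.
have [bef|bef] := sep e e' eS e'S ne.
  by have := pair_color_before GS eS e'S bef; rewrite eq_c ltnn.
by have := pair_color_before GS e'S eS bef; rewrite eq_c ltnn.
Qed.

Lemma pair_color_lt S e d : (forall F v, F \in K -> v \in F -> col v < d) ->
  S \in pairing -> e \in S -> pair_color e < d./2.
Proof.
move=> bK /pairingP[card2 KS _] eS.
have /eqP/cards2P[x [y [nxy def_e]]] := card2 e eS.
have [xe ye] : x \in e /\ y \in e by rewrite def_e !inE !eqxx orbT.
have sub := subsetP (sub_cover eS).
have N1 : col x != col y.
  by apply: contraNneq nxy => /(colK KS) -> //; apply: sub.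
have /(eq_bigmax_cond col)[a ae maxa] : 0 < #|e| by rewrite card2.
have maxP z : z \in e -> col z <= \max_(a in e) col a.
  by move=> ze; apply: (leq_bigmax_cond z).
have M1 := maxP _ xe; have M2 := maxP _ ye.
have B1 := bK _ _ KS (sub a ae); rewrite /pair_color maxa; rewrite maxa in M1 M2; lia.
Qed.

End Pairing.

Lemma balanced_even_gamma (V : finType) (col : V -> nat) (X : {set {set V}}) g d :
  colored col X (g, d) -> (size g <= d./2.+1)%N ->
  exists (U : finType) (G : {set {set U}}),
    [/\ simplicial_complex G, balanced G, cdim G = d./2 &
        forall r, (r <= d./2)%N -> (even_gamma d g)`_r.*2 = (fnum G r)%:R].
Proof.
move=> colX size_g.
have [W [colW [K [[complexK fK iK bK] [F0 F0K cardF0]]]]] := colored_even_gamma colX size_g.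
(* For [d./2 = 0] the colouring maps into an empty type, while the vertex type [{set W}] is
   inhabited; the complex [[set set0]] on [void] is taken instead. *)
move: fK => /= fK; case def_d : d./2 => [|k].
  exists void, [set set0].
  have dim0 : cdim [set set0 : {set void}] = 0%N by rewrite /cdim big_set1 cards0.
  split=> //.
  - split; first by rewrite in_set1.
    by move=> F G; rewrite !in_set1 => /eqP->; rewrite subset0.
  - by exists (fun v : void => match v with end) => F _ [].
  move=> r; rewrite leqn0 => /eqP->; rewrite -fK coef_fpoly /fnum; congr (_%:R).
  transitivity #|[set set0 : {set W}]|; last first.
    rewrite cards1 (_ : [set F in _ | _] = [set set0]) ?cards1 //.
    by apply/setP => F; rewrite !inE; case: eqP => [->|]; rewrite ?cards0 ?eqxx.
  apply: eq_card => F; rewrite !inE cards_eq0; case: eqP => [->|]; rewrite ?andbF // andbT.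
  by case: complexK.
(* A face of [d] vertices, trimmed to even size, yields [d./2] pairs, so the dimension is
   attained. *)
have [S0 GS0 cardS0] : exists2 S, S \in pairing colW K & #|S| = d./2.
  have : (0 < fnum (pairing colW K) d./2)%N.
    rewrite fnum_pairing //; apply/card_gt0P.
    have [F sF cardF] : exists2 F : {set W}, F \subset F0 & #|F| = d./2.*2.
      have /card_gt0P[F] : (0 < #|[set B : {set W} | B \subset F0 & #|B| == d./2.*2]|)%N.
        by rewrite cards_draws bin_gt0 cardF0; lia.
      by rewrite inE => /andP[sF /eqP cF]; exists F.
    by exists F; rewrite inE cardF eqxx andbT; apply: complexK.2 F0K sF.
  by case/card_gt0P => S; rewrite inE => /andP[GS /eqP cS]; exists S.
have dimG : cdim (pairing colW K) = d./2.
  apply/eqP; rewrite eqn_leq -{2}cardS0 leq_cdim // andbT; apply/bigmax_leqP => S GS.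
  have cardC := card_cover_pairing GS.
  have KS : cover S \in K by case/pairingP: GS.
  have colK : colored colW K (even_gamma d g, d) by split.
  by have := card_colored colK KS; rewrite cardC; lia.
exists {set W}, (pairing colW K); split.
- exact: pairing_complex.
- rewrite /balanced dimG def_d; exists (fun e => inord (pair_color colW e)) => S GS e e' eS e'S.
  have lt := pair_color_lt iK bK GS; move/(congr1 val); rewrite /= !inordK -?def_d ?lt //.
  exact: (pair_color_inj iK GS).
- by rewrite dimG.
- by move=> r _; rewrite fnum_pairing // -fK coef_fpoly.
Qed.

(** * From the h-vector to the balanced complex *)

Lemma hpoly0 (T : finType) (D : {set {set T}}) : simplicial_complex D -> (hpoly D)`_0 = 1.
Proof.
move=> [D0 _]; rewrite /hpoly coef_sum big_ord_recl big1 ?addr0 => [|i _]; last first.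
  by rewrite coefZ coefXnM /= mulr0.
rewrite coefZ mul1r /=.
have -> : fnum D 0 = 1%N.
  rewrite /fnum (_ : [set F in D | _] = [set set0]) ?cards1 //; apply/setP => F.
  by rewrite !inE cards_eq0; case: eqP => [->|]; rewrite ?D0 ?andbF.
by rewrite mul1r -horner_coef0 horner_exp !hornerE ?subr0 ?oppr0 ?addr0 expr1n.
Qed.

Theorem theorem1p3 (T : finType) (D : {set {set T}}) :
  simplicial_complex D ->
  (forall i : nat, 0 <= (hpoly D)`_i) ->
  (forall i : nat, (i <= cdim D)%N -> (hpoly D)`_i = (hpoly D)`_(cdim D - i)) ->
  exists g : seq int,
    gamma_vector (Int D) g /\
    exists (U : finType) (G : {set {set U}}),
      simplicial_complex G /\ balanced G /\
      forall i : nat, g`_i = ((fnum G i)%:R : int).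
Proof.
move=> complexD h_ge0 h_sym; set d := cdim D.
have [V [col [X colX]]] := colored_gamma d (hpoly0 complexD) h_ge0.
pose g := \sum_(0 <= i < d./2.+1) (hpoly D)`_i *: gamA d i.
exists (mkseq (fun r => (even_gamma d g)`_r.*2) d./2.+1); split.
  by apply: gamma_Int => //; apply: eulerian_sum_expand.
have size_g : (size g <= d./2.+1)%N.
  apply: size_sum_nat => i; apply: leq_trans (size_scale_leq _ _) _.
  by case: (size_gam d i).
have [U [G [complexG balG dimG fG]]] := balanced_even_gamma colX size_g.
exists U, G; split=> //; split=> // r; case: (ltnP r d./2.+1) => [lt_r|le_r].
  by rewrite nth_mkseq // fG.
(* Beyond [d./2] the sequence returns its default 0, and [G] has no faces of that size. *)
rewrite nth_default ?size_mkseq // (_ : fnum G r = 0%N) //; apply/eqP.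
rewrite cards_eq0 -subset0; apply/subsetP => F; rewrite inE => /andP[/leq_cdim le_F /eqP cF].
by move: le_F; rewrite cF dimG; lia.
Qed.
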